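(* Let $\varphi:\mathbb{D}\to\mathbb{D}$ be analytic. Suppose $\varphi(0)\neq 0$ and $\|\varphi\|_\infty<1$. Then $$\|C_\varphi\| \leq \left\|\frac{\sqrt{1-|\varphi(0)|^2}}{1-\overline{\varphi(0)}\,\varphi}\right\|_\infty < \sqrt{\frac{1+|\varphi(0)|}{1-|\varphi(0)|}}.$$
   Context: $\mathbb{D}=\{z\in\mathbb{C}:|z|<1\}$. $H^2(\mathbb{D})$ is the Hardy space of analytic functions $f(z)=\sum_{n\ge 0}a_nz^n$ on $\mathbb{D}$ with $\|f\|^2=\sum_{n\ge0}|a_n|^2<\infty$. $C_\varphi$ is the composition operator $C_\varphi f=f\circ\varphi$ on $H^2(\mathbb{D})$ (a bounded linear operator on $H^2(\mathbb{D})$ for every analytic $\varphi:\mathbb{D}\to\mathbb{D}$), and $\|C_\varphi\|$ is its operator norm. For an analytic function $\psi:\mathbb{D}\to\mathbb{C}$, $\|\psi\|_\infty=\sup_{z\in\mathbb{D}}|\psi(z)|$. The function inside the middle norm is $z\mapsto \frac{\sqrt{1-|\varphi(0)|^2}}{1-\overline{\varphi(0)}\,\varphi(z)}$ on $\mathbb{D}$. *)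

(* Defs.v *)
From Stdlib Require Import Reals.
From Coquelicot Require Import Coquelicot.

Open Scope R_scope.
Open Scope C_scope.

(* Functions on the unit disc are represented by total functions [C -> C];
   every notion below depends only on their values on the disc. *)
Definition in_disc (z : C) : Prop := Cmod z < 1.

Definition analytic_on_disc (f : C -> C) : Prop :=
  forall z : C, in_disc z -> @ex_derive C_AbsRing C_NormedModule f z.

Definition power_series_on_disc (a : nat -> C) (f : C -> C) : Prop :=
  forall z : C, in_disc z -> @is_pseries C_AbsRing C_NormedModule a z (f z).

Definition in_H2 (f : C -> C) : Prop :=
  analytic_on_disc f /\
  exists a : nat -> C, power_series_on_disc a f /\
    ex_series (fun n => (Cmod (a n) ^ 2)%R).

Definition is_H2_norm (f : C -> C) (r : R) : Prop :=
  exists a : nat -> C, power_series_on_disc a f /\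
    is_series (fun n => (Cmod (a n) ^ 2)%R) (r ^ 2)%R /\ 0 <= r.

(* The coefficients of [f] are unique, so the set below has at most one
   element: the infimum is the Hardy norm if [f] is in H^2, and [p_infty] (the
   infimum of the empty set) if [f] has a power series on the disc whose
   coefficients are not square-summable, or no power series at all. *)
Definition H2_norm (f : C -> C) : Rbar := Glb_Rbar (is_H2_norm f).

Definition comp_op (phi : C -> C) (f : C -> C) : C -> C := fun z => f (phi z).

(* Supremum in the extended reals: finite only if [T] maps the unit ball of
   H^2 into functions of uniformly bounded (in particular finite) norm. *)
Definition op_norm (T : (C -> C) -> (C -> C)) : Rbar :=
  Rbar_lub (fun N : Rbar =>
    exists f : C -> C, in_H2 f /\ Rbar_le (H2_norm f) 1 /\ N = H2_norm (T f)).

Definition sup_norm (psi : C -> C) : Rbar :=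
  Lub_Rbar (fun r : R => exists z : C, in_disc z /\ r = Cmod (psi z)).

(* Main.v *)
Require Import Defs.
From Stdlib Require Import Reals Lra Lia List ClassicalEpsilon.
From Coquelicot Require Import Coquelicot.
Import ListNotations.

(** Write [a = phi 0] and let [k w = sqrt (1 - |a|^2) / (1 - Cconj a * w)], so that
    the middle quantity is the supremum [M] of [|k (phi z)|] over the disc.

    The strict inequality is elementary: if [|phi| <= s < 1], then
    [|1 - Cconj a * phi z| >= 1 - |a| * s > 1 - |a|] because [a <> 0], while the
    right-hand side equals [sqrt (1 - |a|^2) / (1 - |a|)].

    For the norm bound, it is enough that the mean of
    [|f (phi z)|^2 / |k (phi z)|^2] over every circle [|z| = r < 1] is at most the
    square of the norm of [f]. Suppose first that [f] is a polynomial and set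
    [F w = (1 - Cconj a * w) * f w]. The Poisson extension of the values of [|F|^2] on
    the unit circle is the real part of a polynomial [G], and it dominates [|F|^2]
    on the disc ([peval_le_majorant]). As [G (phi z)] is complex differentiable, its
    circle means are [G (phi 0) = G a]. The Poisson kernel at [a] cancels the factor
    [|1 - Cconj a * w|^2] on the unit circle, so [Re (G a)] is [1 - |a|^2] times the
    squared norm of [f] ([majorant_mul_kernel]). These facts are finite identities
    between coefficients. A general [f] is approximated by its partial sums,
    uniformly on [|w| <= s]: this gives [mean_comp_bound].

    To return from circle means to the Hardy norm, [f] composed with [phi] must be
    expanded in a power series, although only complex differentiability is known.
    Goursat's bisection, carried out on annular sectors, shows that circle means of
    complex differentiable functions do not depend on the radius
    ([is_mean_annulus]). Applied to [z * (f z - f z0) / (z - z0)], this yields the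
    Taylor expansion with coefficients the means of [f z / z ^ n] ([taylor]).
    Bessel's inequality on the circle of radius [r] then bounds the sum of
    [|c_n|^2 * r ^ (2 n)] by the mean of the squared modulus, and [r] tends to 1. *)

Open Scope R_scope.

(** * Continuity and complex differentiability *)

Ltac Cext := apply injective_projections; simpl.

Definition Ccts {U : UniformSpace} (u : U -> C) (x : U) : Prop :=
  continuous (fun y => Re (u y)) x /\ continuous (fun y => Im (u y)) x.

(** [C] carries two uniform structures whose identification is not
    definitional; the abbreviation fixes the product one. *)
Notation Ccts_at := (Ccts (U := C_UniformSpace)).

Section Cts.
Context {U : UniformSpace}.
Implicit Types (u v : U -> C) (x : U).

Lemma Ccts_continuous u x : Ccts u x <-> continuous (U := C_UniformSpace) u x.
Proof.
split.
- intros [H1 H2] P [eps HP].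
  assert (K1 : locally x (fun y => ball (Re (u x)) eps (Re (u y))))
    by exact (H1 _ (locally_ball (Re (u x)) eps)).
  assert (K2 : locally x (fun y => ball (Im (u x)) eps (Im (u y))))
    by exact (H2 _ (locally_ball (Im (u x)) eps)).
  change (locally x (fun y => P (u y))).
  generalize (filter_and _ _ K1 K2). apply filter_imp.
  intros y [A B]. apply HP. split; assumption.
- intros H; split; intros P [eps HP];
  assert (K : locally x (fun y => ball (M := C_UniformSpace) (u x) eps (u y)))
    by exact (H _ (locally_ball (u x) eps));
  revert K; unfold filtermap; apply filter_imp;
  intros y [A B]; apply HP; assumption.
Qed.

Lemma Ccts_const (c : C) x : Ccts (fun _ => c) x.
Proof. split; apply continuous_const. Qed.

Lemma Ccts_plus u v x : Ccts u x -> Ccts v x -> Ccts (fun y => u y + v y)%C x.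
Proof. intros [A B] [A' B']; split; simpl; apply @continuous_plus; assumption. Qed.

Lemma Ccts_opp u x : Ccts u x -> Ccts (fun y => - u y)%C x.
Proof. intros [A B]; split; simpl; apply @continuous_opp; assumption. Qed.

Lemma Ccts_minus u v x : Ccts u x -> Ccts v x -> Ccts (fun y => u y - v y)%C x.
Proof. intros A B; apply Ccts_plus; [|apply Ccts_opp]; assumption. Qed.

Lemma Ccts_mult u v x : Ccts u x -> Ccts v x -> Ccts (fun y => u y * v y)%C x.
Proof.
intros [A B] [A' B']; split; simpl.
- apply (continuous_minus (V := R_NormedModule)); apply @continuous_mult; assumption.
- apply (continuous_plus (V := R_NormedModule)); apply @continuous_mult; assumption.
Qed.

Lemma Ccts_RtoC (r : U -> R) x : continuous r x -> Ccts (fun y => RtoC (r y)) x.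
Proof. intros A; split; simpl; [assumption|apply continuous_const]. Qed.

Lemma Ccts_inv u x : Ccts u x -> u x <> 0 -> Ccts (fun y => / u y)%C x.
Proof.
intros [A B] N.
assert (S : continuous (fun y => / (Re (u y) ^ 2 + Im (u y) ^ 2)) x).
{ apply (continuous_comp (fun y => Re (u y) ^ 2 + Im (u y) ^ 2) Rinv).
  - apply (continuous_plus (V := R_NormedModule)); simpl;
    repeat apply @continuous_mult; try assumption; apply continuous_const.
  - apply continuous_Rinv. rewrite <- Cmod2_alt.
    apply pow_nonzero. apply Rgt_not_eq. apply Cmod_gt_0. exact N. }
split; simpl; unfold Rdiv; apply @continuous_mult; auto.
apply @continuous_opp; assumption.
Qed.

Lemma Ccts_div u v x :
  Ccts u x -> Ccts v x -> v x <> 0 -> Ccts (fun y => u y / v y)%C x.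
Proof. intros A B N; apply Ccts_mult; [|apply Ccts_inv]; assumption. Qed.

Lemma Ccts_Cmod u x : Ccts u x -> continuous (fun y => Cmod (u y)) x.
Proof.
intros [A B]. unfold Cmod.
apply (continuous_comp (fun y => fst (u y) ^ 2 + snd (u y) ^ 2) sqrt).
- apply (continuous_plus (V := R_NormedModule)); simpl;
    repeat apply @continuous_mult; try assumption; apply continuous_const.
- apply continuous_sqrt.
Qed.

Lemma Ccts_ext_loc u v x :
  locally x (fun y => u y = v y) -> Ccts u x -> Ccts v x.
Proof.
intros H [A B]; split.
- apply continuous_ext_loc with (2 := A); revert H; apply filter_imp; congruence.
- apply continuous_ext_loc with (2 := B); revert H; apply filter_imp; congruence.
Qed.
End Cts.

Lemma Ccts_comp {U : UniformSpace} (u : U -> C) (f : C -> C) x :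
  Ccts u x -> Ccts_at f (u x) -> Ccts (fun y => f (u y)) x.
Proof.
intros A B. apply Ccts_continuous in A. apply (Ccts_continuous (U := C_UniformSpace)) in B.
apply Ccts_continuous. apply continuous_comp; assumption.
Qed.

Lemma Ccts_id z : Ccts_at (fun w => w) z.
Proof. apply Ccts_continuous, continuous_id. Qed.

Lemma locally_Cmod (z : C) (P : C -> Prop) :
  locally (T := C_UniformSpace) z P <->
  exists d, 0 < d /\ forall w, Cmod (w - z) < d -> P w.
Proof.
split.
- intros [d Hd]. exists d; split; [apply cond_pos|].
  intros w Hw; apply Hd. apply (C_NormedModule_mixin_compat1 z w d). exact Hw.
- intros [d [Hd H]].
  assert (H2 : 0 < d / sqrt 2) by (apply Rdiv_lt_0_compat; [lra|apply sqrt_lt_R0; lra]).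
  exists (mkposreal _ H2). intros w Hw. apply H.
  eapply Rlt_le_trans; [apply (C_NormedModule_mixin_compat2 z w (mkposreal _ H2)); exact Hw|].
  simpl. apply Req_le. field. apply Rgt_not_eq, sqrt_lt_R0; lra.
Qed.

Lemma Ccts_eps (f : C -> C) z :
  Ccts_at f z <->
  (forall e, 0 < e -> exists d, 0 < d /\ forall w, Cmod (w - z) < d -> Cmod (f w - f z) < e).
Proof.
rewrite Ccts_continuous. split.
- intros H e He.
  assert (L : locally (T := C_UniformSpace) (f z) (fun y => Cmod (y - f z) < e))
    by (apply locally_Cmod; exists e; split; auto).
  apply H in L. apply locally_Cmod in L. exact L.
- intros H P HP. apply locally_Cmod in HP. destruct HP as [e [He HP]].
  destruct (H e He) as [d [Hd K]].
  apply locally_Cmod. exists d; split; auto.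
Qed.

(** Carathéodory's form of differentiability: the product, chain and quotient
    rules become algebra on slope functions, and the slope function itself is
    the continuous extension of the difference quotient used for Taylor's
    expansion below. *)
Definition Cdiff (f : C -> C) (z : C) : Prop :=
  exists q : C -> C, Ccts_at q z /\
    forall w, f w = (f z + q w * (w - z))%C.

Lemma Cdiff_cts f z : Cdiff f z -> Ccts_at f z.
Proof.
intros [q [Hq H]].
apply Ccts_ext_loc with (fun w => f z + q w * (w - z))%C.
- apply filter_forall; intros w; symmetry; apply H.
- apply Ccts_plus; [apply Ccts_const|apply Ccts_mult; auto].
  apply Ccts_minus; [apply Ccts_id|apply Ccts_const].
Qed.

Lemma Cdiff_const c z : Cdiff (fun _ => c) z.
Proof. exists (fun _ => 0%C); split; [apply Ccts_const|intros; ring]. Qed.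

Lemma Cdiff_id z : Cdiff (fun w => w) z.
Proof. exists (fun _ => 1%C); split; [apply Ccts_const|intros; ring]. Qed.

Lemma Cdiff_plus f g z : Cdiff f z -> Cdiff g z -> Cdiff (fun w => f w + g w)%C z.
Proof.
intros [p [Hp P]] [q [Hq Q]].
exists (fun w => p w + q w)%C; split; [apply Ccts_plus; auto|].
intros w; rewrite (P w), (Q w); ring.
Qed.

Lemma Cdiff_mult f g z : Cdiff f z -> Cdiff g z -> Cdiff (fun w => f w * g w)%C z.
Proof.
intros F G. assert (Cg := Cdiff_cts _ _ G).
destruct F as [p [Hp P]], G as [q [Hq Q]].
exists (fun w => p w * g w + f z * q w)%C; split.
- apply Ccts_plus; apply Ccts_mult; auto; apply Ccts_const.
- intros w; rewrite (P w), (Q w); ring.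
Qed.

Lemma Cdiff_minus f g z : Cdiff f z -> Cdiff g z -> Cdiff (fun w => f w - g w)%C z.
Proof.
intros [p [Hp P]] [q [Hq Q]].
exists (fun w => p w - q w)%C; split; [apply Ccts_minus; auto|].
intros w; rewrite (P w), (Q w); ring.
Qed.

Lemma Cdiff_pow f n z : Cdiff f z -> Cdiff (fun w => f w ^ n)%C z.
Proof.
intros A; induction n; simpl; [apply Cdiff_const|apply Cdiff_mult; auto].
Qed.

Lemma Cdiff_comp f g z : Cdiff g z -> Cdiff f (g z) -> Cdiff (fun w => f (g w)) z.
Proof.
intros G. assert (Cg := Cdiff_cts _ _ G). destruct G as [q [Hq Q]].
intros [p [Hp P]].
exists (fun w => p (g w) * q w)%C; split.
- apply Ccts_mult; auto. apply Ccts_comp; auto.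
- intros w; rewrite (P (g w)). rewrite (Q w) at 2. ring.
Qed.

Lemma Ceq_dec (z w : C) : {z = w} + {z <> w}.
Proof. apply excluded_middle_informative. Qed.

Lemma Cdiff_ext_loc f g z :
  locally (T := C_UniformSpace) z (fun w => f w = g w) -> Cdiff f z -> Cdiff g z.
Proof.
intros H [q [Hq Q]].
assert (E : f z = g z) by (apply (locally_singleton _ _ H)).
exists (fun w => if Ceq_dec w z then q w else (g w - g z) / (w - z))%C; split.
- apply Ccts_ext_loc with (2 := Hq). revert H; apply filter_imp.
  intros w Hw. destruct (Ceq_dec w z) as [|N]; [reflexivity|].
  rewrite <- Hw, <- E, (Q w). field. intros K; apply N.
  replace w with (w - z + z)%C by ring. rewrite K; ring.
- intros w. destruct (Ceq_dec w z) as [->|N]; [ring|].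
  field. intros K; apply N.
  replace w with (w - z + z)%C by ring. rewrite K; ring.
Qed.

Lemma Cminus_neq0 (w z : C) : w <> z -> (w - z <> 0)%C.
Proof. intros N K; apply N. replace w with (w - z + z)%C by ring. rewrite K; ring. Qed.

(** The slope of the inverse at [z] is [- / (z * w)]; its value at the far away
    point [w = 0] is changed so that the defining identity holds everywhere. *)
Lemma Cdiff_inv (z : C) : z <> 0%C -> Cdiff (fun w => / w)%C z.
Proof.
intros N.
apply Cdiff_ext_loc with (fun w => / z + (- (/ z) * / (if Ceq_dec w 0 then z else w)) * (w - z))%C.
- apply locally_Cmod. exists (Cmod z); split; [apply Cmod_gt_0, N|].
  intros w Hw. destruct (Ceq_dec w 0) as [->|M].
  + exfalso. replace (0 - z)%C with (- z)%C in Hw by ring. rewrite Cmod_opp in Hw; lra.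
  + field. auto.
- exists (fun w => - (/ z) * / (if Ceq_dec w 0 then z else w))%C; split.
  + apply Ccts_ext_loc with (fun w => - (/ z) * / w)%C.
    * apply locally_Cmod. exists (Cmod z); split; [apply Cmod_gt_0, N|].
      intros w Hw. destruct (Ceq_dec w 0) as [->|M]; auto.
      exfalso. replace (0 - z)%C with (- z)%C in Hw by ring. rewrite Cmod_opp in Hw; lra.
    * apply Ccts_mult; [apply Ccts_const|apply Ccts_inv; auto; apply Ccts_id].
  + intros w. ring.
Qed.

Lemma Cdiff_of_ex_derive (f : C -> C) (z : C) :
  @ex_derive C_AbsRing C_NormedModule f z -> Cdiff f z.
Proof.
intros [l [_ H]].
assert (Hz : is_filter_lim (locally (T := AbsRing_UniformSpace C_AbsRing) z) z)
  by (intros P HP; exact HP).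
specialize (H z Hz).
exists (fun w => if Ceq_dec w z then (l : C) else (f w - f z) / (w - z))%C; split.
- apply Ccts_eps. intros e He.
  assert (He2 : 0 < e / 2) by lra.
  specialize (H (mkposreal _ He2)). simpl in H.
  apply locally_C in H. apply locally_Cmod in H. destruct H as [d [Hd H]].
  exists d; split; auto. intros w Hw.
  destruct (Ceq_dec z z) as [_|]; [|congruence].
  destruct (Ceq_dec w z) as [->|N].
  + unfold Cminus; rewrite Cplus_opp_r, Cmod_0; auto.
  + assert (K := H w Hw).
    assert (P : 0 < Cmod (w - z)) by (apply Cmod_gt_0, Cminus_neq0, N).
    change (Cmod (f w - f z - (w - z) * l)%C <= e / 2 * Cmod (w - z)%C) in K.
    replace ((f w - f z) / (w - z) - l)%C with ((f w - f z - (w - z) * l) / (w - z))%C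
      by (field; apply Cminus_neq0, N).
    rewrite Cmod_div by (apply Cminus_neq0, N).
    apply Rmult_lt_reg_r with (Cmod (w - z)); auto.
    unfold Rdiv; rewrite Rmult_assoc, Rinv_l, Rmult_1_r by lra. nra.
- intros w. destruct (Ceq_dec w z) as [->|N]; [ring|].
  field. apply Cminus_neq0, N.
Qed.

(** * Integrals of complex-valued functions of a real variable *)

Definition is_CInt (u : R -> C) (a b : R) (l : C) : Prop :=
  is_RInt (fun t => Re (u t)) a b (Re l) /\ is_RInt (fun t => Im (u t)) a b (Im l).

Lemma is_CInt_plus u v a b l m :
  is_CInt u a b l -> is_CInt v a b m -> is_CInt (fun t => u t + v t)%C a b (l + m)%C.
Proof. intros [A B] [A' B']; split; simpl; apply @is_RInt_plus; assumption. Qed.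

Lemma is_CInt_scal c u a b l :
  is_CInt u a b l -> is_CInt (fun t => c * u t)%C a b (c * l)%C.
Proof.
intros [A B]; split; simpl.
- apply (is_RInt_minus (V := R_NormedModule)); apply (is_RInt_scal (V := R_NormedModule)); assumption.
- apply (is_RInt_plus (V := R_NormedModule)); apply (is_RInt_scal (V := R_NormedModule)); assumption.
Qed.

Lemma is_CInt_opp u a b l : is_CInt u a b l -> is_CInt (fun t => - u t)%C a b (- l)%C.
Proof. intros [A B]; split; simpl; apply @is_RInt_opp; assumption. Qed.

Lemma is_CInt_minus u v a b l m :
  is_CInt u a b l -> is_CInt v a b m -> is_CInt (fun t => u t - v t)%C a b (l - m)%C.
Proof. intros A B; apply is_CInt_plus; [|apply is_CInt_opp]; assumption. Qed.

Lemma is_CInt_ext u v a b l : (forall t, Rmin a b < t < Rmax a b -> u t = v t) ->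
  is_CInt u a b l -> is_CInt v a b l.
Proof.
intros H [A B]; split; eapply is_RInt_ext; eauto; intros t Ht; simpl; rewrite H; auto.
Qed.

Lemma is_CInt_const c a b : is_CInt (fun _ => c) a b (RtoC (b - a) * c)%C.
Proof.
split.
- replace (Re (RtoC (b - a) * c)) with (scal (b - a) (Re c))
    by (unfold scal, Re, Im; simpl; unfold mult; simpl; ring).
  apply @is_RInt_const.
- replace (Im (RtoC (b - a) * c)) with (scal (b - a) (Im c))
    by (unfold scal, Re, Im; simpl; unfold mult; simpl; ring).
  apply @is_RInt_const.
Qed.

Lemma is_CInt_Chasles u a b c l m :
  is_CInt u a b l -> is_CInt u b c m -> is_CInt u a c (l + m)%C.
Proof.
intros [A B] [A' B']; split; simpl; eapply @is_RInt_Chasles; eassumption.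
Qed.

Lemma is_CInt_unique u a b l m : is_CInt u a b l -> is_CInt u a b m -> l = m.
Proof.
intros [A B] [A' B']. apply injective_projections.
- change (Re l = Re m). rewrite <- (is_RInt_unique _ _ _ _ A). exact (is_RInt_unique _ _ _ _ A').
- change (Im l = Im m). rewrite <- (is_RInt_unique _ _ _ _ B). exact (is_RInt_unique _ _ _ _ B').
Qed.

Lemma is_CInt_cts u a b : (forall t, Rmin a b <= t <= Rmax a b -> Ccts u t) ->
  exists l, is_CInt u a b l.
Proof.
intros H.
destruct (ex_RInt_continuous (V := R_CompleteNormedModule) (fun t => Re (u t)) a b) as [x Hx].
{ intros t Ht; apply H, Ht. }
destruct (ex_RInt_continuous (V := R_CompleteNormedModule) (fun t => Im (u t)) a b) as [y Hy].
{ intros t Ht; apply H, Ht. }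
exists (x, y); split; assumption.
Qed.

Lemma is_CInt_Cmod_le u g a b l k : a <= b ->
  (forall t, a <= t <= b -> Cmod (u t) <= g t) ->
  is_CInt u a b l -> is_RInt g a b k -> Cmod l <= k.
Proof.
intros Hab Hg [A B] Hk. rewrite Cmod_norm.
apply norm_RInt_le
  with (f := (u : R -> prod_NormedModule R_AbsRing R_NormedModule R_NormedModule))
    (g := g) (a := a) (b := b); auto.
- intros t Ht. rewrite <- Cmod_norm. auto.
- rewrite (surjective_pairing l). apply is_RInt_fct_extend_pair; assumption.
Qed.

Lemma is_CInt_bound u a b l K : a <= b ->
  (forall t, a <= t <= b -> Cmod (u t) <= K) ->
  is_CInt u a b l -> Cmod l <= (b - a) * K.
Proof.
intros Hab HK H. apply is_CInt_Cmod_le with u (fun _ => K) a b; auto.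
exact (is_RInt_const (V := R_NormedModule) a b K).
Qed.

(** * Parametrization of circles *)

Definition cis (t : R) : C := (cos t, sin t).

Lemma Cmod_cis t : Cmod (cis t) = 1.
Proof.
unfold Cmod, cis; simpl. rewrite !Rmult_1_r, Rplus_comm.
change (sqrt (Rsqr (sin t) + Rsqr (cos t)) = 1). rewrite sin2_cos2. apply sqrt_1.
Qed.

Lemma cis_neq0 t : cis t <> 0%C.
Proof. apply Cmod_gt_0. rewrite Cmod_cis; lra. Qed.

Lemma cis_plus s t : cis (s + t) = (cis s * cis t)%C.
Proof. Cext; [apply cos_plus|rewrite sin_plus; ring]. Qed.

Lemma cis_pow n t : (cis t ^ n)%C = cis (INR n * t).
Proof.
induction n.
- simpl. rewrite Rmult_0_l. unfold cis; rewrite cos_0, sin_0; reflexivity.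
- rewrite Cpow_S, IHn, S_INR, <- cis_plus. f_equal; ring.
Qed.

Lemma cis_opp t : cis (- t) = Cconj (cis t).
Proof. unfold cis; rewrite cos_neg, sin_neg; reflexivity. Qed.

Lemma cis_inv t : (/ cis t)%C = Cconj (cis t).
Proof.
assert (H := cis_neq0 t).
assert (E : (cis t * Cconj (cis t) = 1)%C).
{ rewrite <- Cmod2_conj, Cmod_cis. f_equal; ring. }
replace (Cconj (cis t)) with (/ cis t * (cis t * Cconj (cis t)))%C by (field; auto).
rewrite E; ring.
Qed.

Lemma cos_sin_cts t : continuous cos t /\ continuous sin t.
Proof.
split; apply (ex_derive_continuous (K := R_AbsRing) (V := R_NormedModule)); auto_derive; auto.
Qed.

Lemma cis_cts t : Ccts cis t.
Proof. destruct (cos_sin_cts t); split; assumption. Qed.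

Lemma is_CInt_cis k a b : k <> 0 ->
  is_CInt (fun t => cis (k * t)) a b ((cis (k * b) - cis (k * a)) / (Ci * k))%C.
Proof.
intros Hk.
assert (E : forall z : C, (z / (Ci * k))%C = (Im z / k, - Re z / k)).
{ intros z. Cext; unfold Re, Im; field; auto. }
rewrite E. split; unfold Re, Im, Cminus, Cplus, Copp, cis; simpl.
- replace ((sin _ + _) / k) with (minus (sin (k * b) / k) (sin (k * a) / k))
   by (unfold minus, plus, opp; simpl; field; auto).
  apply (is_RInt_derive (V := R_CompleteNormedModule) (fun t => sin (k * t) / k) (fun t => cos (k * t))).
  + intros t _. auto_derive; auto. field; auto.
  + intros t _. apply continuous_comp with (f := fun t => k * t) (g := cos).
    * apply @continuous_mult; [apply continuous_const|apply continuous_id].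
    * apply cos_sin_cts.
- replace (- _ / k) with (minus (- cos (k * b) / k) (- cos (k * a) / k))
   by (unfold minus, plus, opp; simpl; field; auto).
  apply (is_RInt_derive (V := R_CompleteNormedModule) (fun t => - cos (k * t) / k) (fun t => sin (k * t))).
  + intros t _. auto_derive; auto. field; auto.
  + intros t _. apply continuous_comp with (f := fun t => k * t) (g := sin).
    * apply @continuous_mult; [apply continuous_const|apply continuous_id].
    * apply cos_sin_cts.
Qed.

Lemma is_CInt_Ci_cis a b : is_CInt (fun t => Ci * cis t)%C a b (cis b - cis a)%C.
Proof.
assert (N : RtoC 1 <> 0%C) by (intros H; apply RtoC_inj in H; lra).
assert (N' : Ci <> 0%C) by (intros H; injection H; lra).
replace (cis b - cis a)%C with (Ci * ((cis (1 * b) - cis (1 * a)) / (Ci * 1)))%C.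
- apply is_CInt_scal.
  apply is_CInt_ext with (fun t => cis (1 * t)); [intros; f_equal; ring|].
  apply is_CInt_cis; lra.
- rewrite !Rmult_1_l. field; auto.
Qed.

(** The chord is the integral of the velocity [Ci * cis], which has modulus 1. *)
Lemma cis_lipschitz s t : Cmod (cis t - cis s) <= Rabs (t - s).
Proof.
assert (W : forall s t, s <= t -> Cmod (cis t - cis s) <= t - s).
{ clear s t; intros s t H. replace (t - s) with ((t - s) * 1) by ring.
  apply is_CInt_bound with (fun r => Ci * cis r)%C; auto; [|apply is_CInt_Ci_cis].
  intros r _. rewrite Cmod_mult, Cmod_Ci, Cmod_cis; lra. }
destruct (Rle_dec s t) as [H|H].
- rewrite Rabs_pos_eq by lra. auto.
- rewrite <- Cmod_opp, Rabs_left by lra.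
  replace (- (cis t - cis s))%C with (cis s - cis t)%C by ring.
  replace (- (t - s)) with (s - t) by ring. apply W; lra.
Qed.

(** * Bisection of rectangles *)

Section Bisection.
Variable P : R -> R -> R -> R -> Prop.
Hypothesis Psplit : forall a b c d, a <= b -> c <= d ->
  P a ((a + b) / 2) c ((c + d) / 2) -> P ((a + b) / 2) b c ((c + d) / 2) ->
  P a ((a + b) / 2) ((c + d) / 2) d -> P ((a + b) / 2) b ((c + d) / 2) d ->
  P a b c d.

Let left (p : R * R) : R * R := (fst p, (fst p + snd p) / 2).
Let right (p : R * R) : R * R := ((fst p + snd p) / 2, snd p).
Let Q (p q : R * R) := P (fst p) (snd p) (fst q) (snd q).

Let step (s : (R * R) * (R * R)) : (R * R) * (R * R) :=
  let (p, q) := s in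
  if excluded_middle_informative (Q (left p) (left q)) then
  if excluded_middle_informative (Q (right p) (left q)) then
  if excluded_middle_informative (Q (left p) (right q)) then (right p, right q)
  else (left p, right q) else (right p, left q) else (left p, left q).

Lemma nested_halves (p : nat -> R * R) :
  fst (p O) <= snd (p O) ->
  (forall n, p (S n) = left (p n) \/ p (S n) = right (p n)) ->
  (forall n, snd (p n) - fst (p n) = (snd (p O) - fst (p O)) * (/ 2) ^ n) /\
  exists x, forall n, fst (p n) <= x <= snd (p n).
Proof.
intros H0 H.
assert (L : forall n, snd (p n) - fst (p n) = (snd (p O) - fst (p O)) * (/ 2) ^ n).
{ induction n; simpl; [ring|].
  destruct (H n) as [E|E]; rewrite E; simpl; nra. }
split; auto.
assert (Pos : forall n, fst (p n) <= snd (p n)).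
{ intros n. assert (K := L n). assert (0 <= (/ 2) ^ n) by (apply pow_le; lra). nra. }
assert (M : forall n, fst (p n) <= fst (p (S n)) /\ snd (p (S n)) <= snd (p n)).
{ intros n. assert (K := Pos n). destruct (H n) as [E|E]; rewrite E; simpl; lra. }
destruct (ex_lim_seq_adj (fun n => fst (p n)) (fun n => snd (p n))) as [[x Hx] [[y Hy] E]].
- intros n; apply M.
- intros n; apply M.
- apply is_lim_seq_ext with (fun n => (snd (p O) - fst (p O)) * (/ 2) ^ n).
  { intros n; symmetry; apply L. }
  replace (Finite 0) with (Rbar_mult (snd (p O) - fst (p O)) 0) by (simpl; f_equal; ring).
  apply is_lim_seq_scal_l. apply is_lim_seq_geom. rewrite Rabs_pos_eq; lra.
- rewrite (is_lim_seq_unique _ _ Hx), (is_lim_seq_unique _ _ Hy) in E. injection E as E.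
  exists x. intros n. split.
  + apply (is_lim_seq_incr_compare _ _ Hx). intros m; apply M.
  + rewrite E. apply (is_lim_seq_decr_compare _ _ Hy). intros m; apply M.
Qed.

(** A property of rectangles that passes from the four quarters to the whole
    holds as soon as it holds for all small rectangles around each point:
    otherwise it would fail on nested quarters shrinking to a point. Cutting
    at the midpoints makes the sum of the squares of the sides additive, which
    Goursat's lemma relies on. *)
Lemma bisection2 A B C D : A <= B -> C <= D ->
  (forall x y, A <= x <= B -> C <= y <= D -> exists del, 0 < del /\
    forall a b c d, A <= a -> b <= B -> C <= c -> d <= D ->
      a <= x <= b -> c <= y <= d -> b - a < del -> d - c < del -> P a b c d) ->
  P A B C D.
Proof.
intros HAB HCD Hloc.
destruct (excluded_middle_informative (P A B C D)) as [|N]; auto. exfalso.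
pose (s := fix s n := match n with O => ((A, B), (C, D)) | S n => step (s n) end).
assert (H1 : forall n, fst (s (S n)) = left (fst (s n)) \/ fst (s (S n)) = right (fst (s n))).
{ intros n; simpl. destruct (s n) as [p q]; unfold step.
  repeat destruct excluded_middle_informative; simpl; auto. }
assert (H2 : forall n, snd (s (S n)) = left (snd (s n)) \/ snd (s (S n)) = right (snd (s n))).
{ intros n; simpl. destruct (s n) as [p q]; unfold step.
  repeat destruct excluded_middle_informative; simpl; auto. }
destruct (nested_halves (fun n => fst (s n)) HAB H1) as [L1 [x Hx]].
destruct (nested_halves (fun n => snd (s n)) HCD H2) as [L2 [y Hy]].
simpl in L1, L2.
assert (Hn : forall n, ~ Q (fst (s n)) (snd (s n))).
{ induction n; [exact N|].
  assert (K1 := Hx n). assert (K2 := Hy n). revert IHn K1 K2; simpl.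
  destruct (s n) as [p q]; unfold step; simpl.
  repeat destruct excluded_middle_informative; simpl; auto.
  intros IH K1 K2 F. apply IH. apply Psplit; auto; lra. }
assert (Hin : forall n, A <= fst (fst (s n)) /\ snd (fst (s n)) <= B /\
   C <= fst (snd (s n)) /\ snd (snd (s n)) <= D).
{ induction n; [simpl; lra|].
  assert (K1 := Hx n). assert (K2 := Hy n).
  destruct (H1 n) as [E1|E1], (H2 n) as [E2|E2]; rewrite E1, E2; simpl; lra. }
destruct (Hloc x y (Hx O) (Hy O)) as [del [Hdel Hl]].
destruct (pow_lt_1_zero (/ 2)) with (y := del / (B - A + D - C + 1)) as [n Hn'].
{ rewrite Rabs_pos_eq; lra. }
{ apply Rdiv_lt_0_compat; lra. }
specialize (Hn' n (le_n n)).
rewrite Rabs_pos_eq in Hn' by (apply pow_le; lra).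
apply Rmult_lt_compat_r with (r := B - A + D - C + 1) in Hn'; [|lra].
unfold Rdiv in Hn'; rewrite Rmult_assoc, Rinv_l, Rmult_1_r in Hn' by lra.
assert (0 <= (/ 2) ^ n) by (apply pow_le; lra).
apply (Hn n). destruct (Hin n) as [I1 [I2 [I3 I4]]].
apply Hl; auto; rewrite ?L1, ?L2; nra.
Qed.
End Bisection.

Definition CInt (u : R -> C) (a b : R) : C :=
  (RInt (fun t => Re (u t)) a b, RInt (fun t => Im (u t)) a b).

Lemma is_CInt_CInt u a b l : is_CInt u a b l -> CInt u a b = l.
Proof. intros [A B]. Cext; apply is_RInt_unique; assumption. Qed.

Lemma CInt_correct u a b : (forall t, Rmin a b <= t <= Rmax a b -> Ccts u t) ->
  is_CInt u a b (CInt u a b).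
Proof.
intros H. destruct (is_CInt_cts u a b H) as [l Hl]. rewrite (is_CInt_CInt _ _ _ _ Hl). exact Hl.
Qed.

Lemma Cmod_circle r t : 0 <= r -> Cmod (r * cis t) = r.
Proof. intros H. rewrite Cmod_mult, Cmod_cis, Cmod_R, Rabs_pos_eq; lra. Qed.

Lemma circle_cts r t : Ccts (fun s => r * cis s)%C t.
Proof. apply Ccts_mult; [apply Ccts_const|apply cis_cts]. Qed.

Lemma ray_cts r t : Ccts (fun s => RtoC s * cis t)%C r.
Proof. apply Ccts_mult; [apply Ccts_RtoC, continuous_id|apply Ccts_const]. Qed.

Lemma RtoC_neq0 (r : R) : r <> 0 -> RtoC r <> 0%C.
Proof. intros H K. apply RtoC_inj in K. auto. Qed.

(** * Goursat's lemma on annular sectors *)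

Section Goursat.
Variables (g : C -> C) (A B : R).
Hypothesis A_pos : 0 < A.
Hypothesis g_diff : forall z, A <= Cmod z <= B -> Cdiff g z.

Let arcs (a b t : R) : C := (Ci * (g (b * cis t) - g (a * cis t)))%C.
Let rays (c d r : R) : C := ((g (RtoC r * cis d) - g (RtoC r * cis c)) / RtoC r)%C.

(** The integral of [g z / z] along the boundary of the sector with radii in
    [[a, b]] and angles in [[c, d]]. The weight [1 / z] turns the arcs into plain
    integrals in the angle. *)
Definition boundary_integral (a b c d : R) : C :=
  (CInt (arcs a b) c d - CInt (rays c d) a b)%C.

Lemma arcs_cts a b t : A <= a <= B -> A <= b <= B -> Ccts (arcs a b) t.
Proof.
intros Ha Hb. apply Ccts_mult; [apply Ccts_const|].
apply Ccts_minus; apply Ccts_comp; try apply circle_cts;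
 apply Cdiff_cts, g_diff; rewrite Cmod_circle; lra.
Qed.

Lemma rays_cts c d r : A <= r <= B -> Ccts (rays c d) r.
Proof.
intros Hr. apply Ccts_div.
- apply Ccts_minus; (apply (Ccts_comp (fun s => RtoC s * cis _)%C g); [apply ray_cts|]);
  apply Cdiff_cts, g_diff; rewrite Cmod_circle; lra.
- apply Ccts_RtoC, continuous_id.
- apply RtoC_neq0; lra.
Qed.

Lemma is_CInt_arcs a b c d : A <= a <= B -> A <= b <= B ->
  is_CInt (arcs a b) c d (CInt (arcs a b) c d).
Proof. intros; apply CInt_correct; intros; apply arcs_cts; auto. Qed.

Lemma is_CInt_rays a b c d : A <= a <= b -> b <= B ->
  is_CInt (rays c d) a b (CInt (rays c d) a b).
Proof.
intros; apply CInt_correct; intros t Ht; apply rays_cts.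
rewrite Rmin_left, Rmax_right in Ht; lra.
Qed.

Lemma boundary_integral_split a m b c n d : A <= a <= m -> m <= b <= B ->
  boundary_integral a b c d =
   (boundary_integral a m c n + boundary_integral m b c n +
    boundary_integral a m n d + boundary_integral m b n d)%C.
Proof.
intros H1 H2.
assert (E1 : CInt (arcs a b) c d =
  (CInt (arcs a m) c n + CInt (arcs m b) c n + (CInt (arcs a m) n d + CInt (arcs m b) n d))%C).
{ apply is_CInt_CInt. apply is_CInt_Chasles with n;
  (eapply is_CInt_ext; [|apply is_CInt_plus; apply is_CInt_arcs; lra]);
  intros t _; unfold arcs; ring. }
assert (E2 : CInt (rays c d) a b =
  (CInt (rays c n) a m + CInt (rays n d) a m + (CInt (rays c n) m b + CInt (rays n d) m b))%C).
{ apply is_CInt_CInt. apply is_CInt_Chasles with m;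
  (eapply is_CInt_ext; [|apply is_CInt_plus; apply is_CInt_rays; lra]);
  intros t _; unfold rays; unfold Cdiv; ring. }
unfold boundary_integral. rewrite E1, E2. ring.
Qed.

(** Affine functions have zero boundary integral, so the boundary integral of
    [g] is that of its error to first order. Here [b - a + B * (d - c)] bounds the
    diameter of the sector. *)
Lemma boundary_integral_small z0 K e a b c d x y :
  A <= a -> b <= B -> a <= x <= b -> c <= y <= d -> 0 <= e ->
  z0 = (x * cis y)%C ->
  (forall w, Cmod (w - z0) <= (b - a) + B * (d - c) ->
     Cmod (g w - g z0 - K * (w - z0)) <= e * ((b - a) + B * (d - c))) ->
  Cmod (boundary_integral a b c d) <=
   2 * e * ((b - a) + B * (d - c)) * ((d - c) + (b - a) / A).
Proof.
intros Ha Hb Hx Hy He Hz0 Hg.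
set (s := (b - a) + B * (d - c)) in *.
pose (err := fun w => (g w - g z0 - K * (w - z0))%C).
assert (Herr : forall r t, a <= r <= b -> c <= t <= d -> Cmod (err (r * cis t)%C) <= e * s).
{ intros r t Hr Ht. apply Hg. rewrite Hz0.
  replace (r * cis t - x * cis y)%C with (RtoC (r - x) * cis y + r * (cis t - cis y))%C
    by (rewrite RtoC_minus; ring).
  eapply Rle_trans; [apply Cmod_triangle|]. rewrite !Cmod_mult, Cmod_cis, !Cmod_R.
  assert (L := cis_lipschitz y t). rewrite (Rabs_pos_eq r) by lra.
  assert (Rabs (r - x) <= b - a) by (apply Rabs_le; lra).
  assert (Rabs (t - y) <= d - c) by (apply Rabs_le; lra).
  assert (0 <= Cmod (cis t - cis y)) by apply Cmod_ge_0.
  unfold s. nra. }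
(* The affine part contributes [l] to both the arcs and the rays, so it cancels;
   only the error term is left to be estimated. *)
pose (l := (RtoC (b - a) * K * (cis d - cis c))%C).
assert (E1 : is_CInt (fun t => Ci * (err (b * cis t) - err (a * cis t)))%C c d
   (CInt (arcs a b) c d - l)).
{ apply is_CInt_ext with (fun t => arcs a b t - RtoC (b - a) * K * (Ci * cis t))%C.
  - intros t _. unfold arcs, err. rewrite RtoC_minus. ring.
  - apply is_CInt_minus; [apply is_CInt_arcs; lra|].
    apply is_CInt_scal, is_CInt_Ci_cis. }
assert (E2 : is_CInt (fun r => (err (RtoC r * cis d) - err (RtoC r * cis c)) / RtoC r)%C a b
   (CInt (rays c d) a b - l)).
{ apply is_CInt_ext with (fun r => rays c d r - K * (cis d - cis c))%C.
  - rewrite Rmin_left, Rmax_right by lra.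
    intros r Hr. unfold rays, err. field. apply RtoC_neq0; lra.
  - apply is_CInt_minus; [apply is_CInt_rays; lra|].
    replace l with (RtoC (b - a) * (K * (cis d - cis c)))%C by (unfold l; ring).
    apply is_CInt_const. }
unfold boundary_integral.
replace (CInt (arcs a b) c d - CInt (rays c d) a b)%C with
  ((CInt (arcs a b) c d - l) + - (CInt (rays c d) a b - l))%C by ring.
eapply Rle_trans; [apply Cmod_triangle|]. rewrite Cmod_opp.
apply is_CInt_bound with (K := 2 * (e * s)) in E1; [|lra|].
2:{ intros t Ht. rewrite Cmod_mult, Cmod_Ci, Rmult_1_l.
    unfold Cminus. eapply Rle_trans; [apply Cmod_triangle|]. rewrite Cmod_opp.
    assert (K1 := Herr b t ltac:(lra) Ht). assert (K2 := Herr a t ltac:(lra) Ht). lra. }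
apply is_CInt_bound with (K := 2 * (e * s) / A) in E2; [|lra|].
2:{ intros r Hr. rewrite Cmod_div by (apply RtoC_neq0; lra).
    rewrite Cmod_R, Rabs_pos_eq by lra.
    assert (K1 := Herr r d Hr ltac:(lra)). assert (K2 := Herr r c Hr ltac:(lra)).
    assert (K3 := Cmod_triangle (err (r * cis d)%C) (- err (r * cis c)%C)).
    rewrite Cmod_opp in K3.
    apply Rmult_le_compat; [apply Cmod_ge_0| |unfold Cminus; lra|].
    - left; apply Rinv_0_lt_compat; lra.
    - apply Rinv_le_contravar; lra. }
unfold Rdiv in *.
replace (2 * e * s * (d - c + (b - a) * / A)) with
 ((d - c) * (2 * (e * s)) + (b - a) * (2 * (e * s) * / A)) by ring.
lra.
Qed.

(** By [boundary_integral_small], differentiability makes the boundary integral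
    of a small sector at most [e] times the sum of the squares of its sides, and
    that bound is additive under bisection. *)
Lemma Goursat_annular_sector c d : A <= B -> c <= d -> boundary_integral A B c d = 0%C.
Proof.
intros HAB Hcd. apply Cmod_eq_0.
pose (k := (1 + B) * (1 + / A)).
assert (IA : 0 < / A) by (apply Rinv_0_lt_compat; lra).
assert (Hk : 0 < k) by (unfold k; nra).
assert (S : forall e, 0 < e ->
  Cmod (boundary_integral A B c d) <= e * ((B - A) ^ 2 + (d - c) ^ 2)).
{ intros e He.
  assert (X : A <= A -> B <= B ->
   Cmod (boundary_integral A B c d) <= e * ((B - A) ^ 2 + (d - c) ^ 2)); [|apply X; lra].
  apply (bisection2 (fun a b c d => A <= a -> b <= B ->
     Cmod (boundary_integral a b c d) <= e * ((b - a) ^ 2 + (d - c) ^ 2))); auto.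
  - clear c d Hcd. intros a b c d Hab Hcd H1 H2 H3 H4 Ha Hb.
    rewrite (boundary_integral_split a ((a + b) / 2) b c ((c + d) / 2) d) by lra.
    specialize (H1 ltac:(lra) ltac:(lra)). specialize (H2 ltac:(lra) ltac:(lra)).
    specialize (H3 ltac:(lra) ltac:(lra)). specialize (H4 ltac:(lra) ltac:(lra)).
    assert (T : forall p q r s : C,
      Cmod (p + q + r + s) <= Cmod p + Cmod q + Cmod r + Cmod s).
    { intros p q r s. assert (T1 := Cmod_triangle (p + q + r) s).
      assert (T2 := Cmod_triangle (p + q) r). assert (T3 := Cmod_triangle p q). lra. }
    eapply Rle_trans; [apply T|].
    (* Halving both sides makes the four right-hand sides add up exactly. *)
    replace (e * ((b - a) ^ 2 + (d - c) ^ 2)) with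
      (e * (((a + b) / 2 - a) ^ 2 + ((c + d) / 2 - c) ^ 2) +
       e * ((b - (a + b) / 2) ^ 2 + ((c + d) / 2 - c) ^ 2) +
       e * (((a + b) / 2 - a) ^ 2 + (d - (c + d) / 2) ^ 2) +
       e * ((b - (a + b) / 2) ^ 2 + (d - (c + d) / 2) ^ 2)) by field.
    lra.
  - intros x y Hx Hy.
    destruct (g_diff (x * cis y)%C) as [q [Hq Q]].
    { rewrite Cmod_circle; lra. }
    apply Ccts_eps with (e := e / (4 * k)) in Hq.
    2:{ apply Rdiv_lt_0_compat; lra. }
    destruct Hq as [dl [Hdl Hq]].
    exists (dl / (2 * (1 + B))). split; [apply Rdiv_lt_0_compat; lra|].
    intros a b c' d' Ha Hb _ _ Hxab Hycd Hba Hdc _ _.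
    assert (Hs : (b - a) + B * (d' - c') < dl).
    { assert (E : dl = dl / (2 * (1 + B)) * (2 * (1 + B))) by (field; lra).
      set (dd := dl / (2 * (1 + B))) in *. nra. }
    eapply Rle_trans.
    { apply boundary_integral_small with (z0 := (x * cis y)%C) (K := q (x * cis y)%C)
       (e := e / (4 * k)) (x := x) (y := y); auto.
      - left; apply Rdiv_lt_0_compat; lra.
      - intros w Hw. rewrite (Q w) at 1.
        replace (g (x * cis y) + q w * (w - x * cis y) - g (x * cis y) - q (x * cis y) * (w - x * cis y))%C
         with ((q w - q (x * cis y)) * (w - x * cis y))%C by ring.
        rewrite Cmod_mult. apply Rmult_le_compat; try apply Cmod_ge_0; auto.
        left; apply Hq. lra. }
    assert (T1 : (b - a) + B * (d' - c') <= (1 + B) * ((b - a) + (d' - c'))) by nra.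
    assert (T2 : (d' - c') + (b - a) / A <= (1 + / A) * ((b - a) + (d' - c'))).
    { unfold Rdiv; nra. }
    apply Rle_trans with
      (2 * (e / (4 * k)) *
        (((1 + B) * ((b - a) + (d' - c'))) * ((1 + / A) * ((b - a) + (d' - c'))))).
    + rewrite Rmult_assoc. apply Rmult_le_compat_l.
      { assert (0 < e / (4 * k)) by (apply Rdiv_lt_0_compat; lra). lra. }
      assert (0 <= B * (d' - c')) by (apply Rmult_le_pos; lra).
      assert (0 <= (b - a) / A) by (apply Rmult_le_pos; lra).
      apply Rmult_le_compat; auto; lra.
    + replace (2 * (e / (4 * k)) * ((1 + B) * (b - a + (d' - c')) * ((1 + / A) * (b - a + (d' - c')))))
        with (e / 2 * ((b - a) + (d' - c')) ^ 2).
      2:{ unfold k. field. split; [lra|]. split; lra. }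
      assert (0 <= e * ((b - a) - (d' - c')) ^ 2) by (apply Rmult_le_pos; [lra|apply pow2_ge_0]).
      lra. }
apply Rle_antisym; [|apply Cmod_ge_0].
apply Rle_trans with (real 0); [|simpl; lra].
apply le_epsilon. intros e He.
set (T := (B - A) ^ 2 + (d - c) ^ 2) in *.
assert (0 <= T) by (unfold T; nra).
specialize (S (e / (T + 1)) ltac:(apply Rdiv_lt_0_compat; lra)).
eapply Rle_trans; [exact S|]. simpl. rewrite Rplus_0_l.
apply Rmult_le_reg_r with (T + 1); [lra|].
replace (e / (T + 1) * T * (T + 1)) with (e * T) by (field; lra). nra.
Qed.
End Goursat.

(** * Circle means *)

Definition is_mean (g : C -> C) (r : R) (m : C) : Prop :=
  is_CInt (fun t => g (r * cis t))%C 0 (2 * PI) (RtoC (2 * PI) * m)%C.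

(** On a full turn the two rays coincide and cancel, so only the two circles
    remain in Goursat's lemma. *)
Lemma is_mean_annulus g a b m : 0 < a <= b ->
  (forall z, a <= Cmod z <= b -> Cdiff g z) ->
  is_mean g a m -> is_mean g b m.
Proof.
intros Hab Hg Hm. assert (P := PI_RGT_0).
assert (H := Goursat_annular_sector g a b ltac:(lra) Hg 0 (2 * PI) ltac:(lra) ltac:(lra)).
unfold boundary_integral in H.
assert (Z : CInt (fun r => (g (RtoC r * cis (2 * PI)) - g (RtoC r * cis 0)) / RtoC r)%C a b = 0%C).
{ apply is_CInt_CInt. apply is_CInt_ext with (fun _ => 0%C).
  - intros t _. replace (cis (2 * PI)) with (cis 0).
    + unfold Cdiv; ring.
    + unfold cis. rewrite cos_0, sin_0, cos_2PI, sin_2PI; reflexivity.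
  - replace (RtoC 0) with (RtoC (b - a) * 0)%C at 1 by ring. apply is_CInt_const. }
rewrite Z in H.
assert (N' : Ci <> 0%C) by (intros K; injection K; lra).
assert (I := is_CInt_arcs g a b ltac:(lra) Hg a b 0 (2 * PI) ltac:(lra) ltac:(lra)).
unfold is_mean.
replace (RtoC (2 * PI) * m)%C with
 (- Ci * CInt (fun t => Ci * (g (b * cis t) - g (a * cis t)))%C 0 (2 * PI) + RtoC (2 * PI) * m)%C.
- apply is_CInt_ext with (fun t => - Ci * (Ci * (g (b * cis t) - g (a * cis t))) + g (a * cis t))%C.
  + intros t _. transitivity (- (Ci * Ci) * (g (b * cis t) - g (a * cis t)) + g (a * cis t))%C; [ring|].
    replace (Ci * Ci)%C with (- (1))%C by (Cext; ring). ring.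
  + apply is_CInt_plus; auto. apply is_CInt_scal; auto.
- replace (_ - 0)%C with (CInt (fun t => Ci * (g (b * cis t) - g (a * cis t)))%C 0 (2 * PI)) in H by ring.
  rewrite H. ring.
Qed.

Lemma is_mean_plus f g r a b :
  is_mean f r a -> is_mean g r b -> is_mean (fun z => f z + g z)%C r (a + b)%C.
Proof.
intros F G. unfold is_mean. rewrite Cmult_plus_distr_l. apply is_CInt_plus; assumption.
Qed.

Lemma is_mean_scal c f r a : is_mean f r a -> is_mean (fun z => c * f z)%C r (c * a)%C.
Proof.
intros F. unfold is_mean.
replace (RtoC (2 * PI) * (c * a))%C with (c * (RtoC (2 * PI) * a))%C by ring.
exact (is_CInt_scal c _ _ _ _ F).
Qed.

Lemma is_mean_minus f g r a b :
  is_mean f r a -> is_mean g r b -> is_mean (fun z => f z - g z)%C r (a - b)%C.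
Proof.
intros F G. unfold is_mean.
replace (RtoC (2 * PI) * (a - b))%C with (RtoC (2 * PI) * a - RtoC (2 * PI) * b)%C by ring.
apply is_CInt_minus; assumption.
Qed.

Lemma is_mean_conj f r a : is_mean f r a -> is_mean (fun z => Cconj (f z)) r (Cconj a).
Proof.
unfold is_mean.
replace (RtoC (2 * PI) * Cconj a)%C with (Cconj (RtoC (2 * PI) * a)) by (Cext; ring).
intros [A B]. split; simpl; [assumption|]. apply @is_RInt_opp; assumption.
Qed.

Lemma is_mean_ext f g r a : 0 <= r ->
  (forall z, Cmod z = r -> f z = g z) -> is_mean f r a -> is_mean g r a.
Proof.
intros Hr H. apply is_CInt_ext. intros t _. apply H. apply Cmod_circle, Hr.
Qed.

Lemma is_mean_const c r : is_mean (fun _ => c) r c.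
Proof.
unfold is_mean. replace (2 * PI) with (2 * PI - 0) at 2 by ring. apply is_CInt_const.
Qed.

Lemma two_PI_neq0 : RtoC (2 * PI) <> 0%C.
Proof. apply RtoC_neq0. assert (P := PI_RGT_0); lra. Qed.

Lemma is_mean_unique f r a b : is_mean f r a -> is_mean f r b -> a = b.
Proof.
intros F G. assert (E := is_CInt_unique _ _ _ _ _ F G). assert (N := two_PI_neq0).
replace a with (/ RtoC (2 * PI) * (RtoC (2 * PI) * a))%C by (field; auto).
rewrite E. field; auto.
Qed.

Lemma is_mean_exists (f : C -> C) r : 0 <= r -> (forall z, Cmod z = r -> Ccts_at f z) ->
  exists m, is_mean f r m.
Proof.
intros Hr H. destruct (is_CInt_cts (fun t => f (r * cis t)%C) 0 (2 * PI)) as [l Hl].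
- intros t _. apply (Ccts_comp (fun s => r * cis s)%C); [apply circle_cts|].
  apply H, Cmod_circle, Hr.
- exists (/ RtoC (2 * PI) * l)%C. unfold is_mean.
  replace (_ * (_ * l))%C with l; [exact Hl|]. field. apply two_PI_neq0.
Qed.

Lemma is_mean_Cmod_le f g r a k : 0 <= r ->
  (forall z, Cmod z = r -> Cmod (f z) <= g z) ->
  is_mean f r a -> is_mean (fun z => RtoC (g z)) r (RtoC k) -> Cmod a <= k.
Proof.
intros Hr H F [G _]. assert (P := PI_RGT_0).
assert (E := is_CInt_Cmod_le _ (fun t => g (r * cis t)%C) 0 (2 * PI) _ (2 * PI * k) ltac:(lra)
  (fun t _ => H _ (Cmod_circle r t Hr)) F).
rewrite Cmod_mult, Cmod_R, Rabs_pos_eq in E by lra.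
apply Rmult_le_reg_l with (2 * PI); [lra|]. apply E.
replace (2 * PI * k) with (Re (RtoC (2 * PI) * RtoC k)) by (unfold Re; simpl; ring).
exact G.
Qed.

Lemma is_mean_Re_le f g r a b : 0 <= r ->
  (forall z, Cmod z = r -> Re (f z) <= Re (g z)) ->
  is_mean f r a -> is_mean g r b -> Re a <= Re b.
Proof.
intros Hr H [F _] [G _]. assert (P := PI_RGT_0).
assert (E : Re (RtoC (2 * PI) * a) <= Re (RtoC (2 * PI) * b)).
{ apply (is_RInt_le _ _ 0 (2 * PI) _ _ ltac:(lra) F G). intros t _. apply H, Cmod_circle, Hr. }
unfold Re in *; simpl in E. apply Rmult_le_reg_l with (2 * PI); lra.
Qed.

(** Circle means depend continuously on the radius, by uniform continuity of
    [f] near the circle. *)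
Lemma is_mean_limit (f : C -> C) r c : 0 <= r -> (forall z, Cmod z = r -> Ccts_at f z) ->
  (forall d, 0 < d -> exists s, Rabs (s - r) < d /\ is_mean f s c) -> is_mean f r c.
Proof.
intros Hr Hf Hs. assert (P := PI_RGT_0).
destruct (is_mean_exists f r Hr Hf) as [m Hm].
replace c with m; auto.
assert (N : forall t, Ccts (fun p : R * R => f (RtoC (fst p) * cis (snd p))%C) (r, t)).
{ intros t. apply (Ccts_comp (U := prod_UniformSpace R_UniformSpace R_UniformSpace)
    (fun p : R * R => RtoC (fst p) * cis (snd p))%C f).
  - apply Ccts_mult.
    + apply Ccts_RtoC. apply continuous_fst.
    + destruct (cos_sin_cts t).
      split; simpl;
      [apply (continuous_comp (snd (B:=R)) cos)|apply (continuous_comp (snd (B:=R)) sin)];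
      auto; apply continuous_snd.
  - apply Hf, Cmod_circle, Hr. }
assert (D : (m - c = 0)%C).
{ apply Cmod_eq_0. apply Rle_antisym; [|apply Cmod_ge_0].
  apply Rle_trans with (0 : R); [|simpl; lra].
  apply le_epsilon. intros e He. rewrite Rplus_0_l.
  assert (He2 : 0 < e / 2) by lra.
  destruct (uniform_continuity_2d_1d' (fun x y => Re (f (RtoC x * cis y)%C)) 0 (2 * PI) r)
    with (eps := mkposreal _ He2) as [d1 Hd1].
  { intros t _. apply continuity_2d_pt_filterlim. apply (N t). }
  destruct (uniform_continuity_2d_1d' (fun x y => Im (f (RtoC x * cis y)%C)) 0 (2 * PI) r)
    with (eps := mkposreal _ He2) as [d2 Hd2].
  { intros t _. apply continuity_2d_pt_filterlim. apply (N t). }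
  destruct (Hs (Rmin d1 d2)) as [s [Hsr Hsm]].
  { apply Rmin_pos; apply cond_pos. }
  assert (M := Rmin_l d1 d2). assert (M' := Rmin_r d1 d2).
  assert (B1 := is_CInt_minus _ _ _ _ _ _ Hm Hsm).
  apply is_CInt_bound with (K := e) in B1; [|lra|].
  - replace (RtoC (2 * PI) * m - RtoC (2 * PI) * c)%C with (RtoC (2 * PI) * (m - c))%C in B1 by ring.
    rewrite Cmod_mult, Cmod_R, Rabs_pos_eq in B1 by lra.
    rewrite Rminus_0_r in B1. apply Rmult_le_reg_l with (2 * PI); lra.
  - intros t Ht.
    apply Rabs_def2 in Hsr.
    assert (K1 := Hd1 t r t s Ht ltac:(destruct d1; simpl in *; lra) Ht
       ltac:(lra)).
    assert (K2 := Hd2 t r t s Ht ltac:(destruct d2; simpl in *; lra) Ht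
       ltac:(lra)).
    rewrite Rminus_diag, Rabs_R0 in K1, K2.
    specialize (K1 (cond_pos d1)). specialize (K2 (cond_pos d2)). simpl in K1, K2.
    rewrite <- Cmod_opp.
    replace (- (f (r * cis t) - f (s * cis t)))%C with (f (s * cis t) - f (r * cis t))%C by ring.
    rewrite (surjective_pairing (f (s * cis t) - f (r * cis t))%C).
    set (x := fst _). set (y := snd _).
    change (Rabs x < e / 2) in K1. change (Rabs y < e / 2) in K2.
    replace ((x, y) : C) with (RtoC x + Ci * RtoC y)%C by (Cext; ring).
    eapply Rle_trans; [apply Cmod_triangle|].
    rewrite Cmod_mult, Cmod_Ci, !Cmod_R. lra. }
replace m with (m - c + c)%C by ring. rewrite D; ring.
Qed.

Lemma is_mean_annulus_inv g a b m : 0 < a <= b ->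
  (forall z, a <= Cmod z <= b -> Cdiff g z) ->
  is_mean g b m -> is_mean g a m.
Proof.
intros Hab Hg Hm.
destruct (is_mean_exists g a) as [m' Hm'].
- lra.
- intros z Hz; apply Cdiff_cts, Hg; lra.
- rewrite (is_mean_unique _ _ _ _ Hm (is_mean_annulus _ _ _ _ Hab Hg Hm')). exact Hm'.
Qed.

Lemma is_mean_interval (f : C -> C) a b m : 0 <= a < b ->
  (forall z, a <= Cmod z <= b -> Ccts_at f z) ->
  (forall z, a < Cmod z < b -> Cdiff f z) ->
  is_mean f a m -> is_mean f b m.
Proof.
intros Hab Hc Hd Hm.
destruct (is_mean_exists f ((a + b) / 2)) as [c Hmid].
- lra.
- intros z Hz; apply Hc; lra.
- assert (K : forall r, a < r < b -> is_mean f r c).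
  { intros r Hr. destruct (Rle_dec r ((a + b) / 2)).
    - apply is_mean_annulus_inv with ((a + b) / 2); auto; [lra|]. intros; apply Hd; lra.
    - apply is_mean_annulus with ((a + b) / 2); auto; [lra|]. intros; apply Hd; lra. }
  assert (Ea : is_mean f a c).
  { apply is_mean_limit; [lra|intros; apply Hc; lra|].
    intros d Hd'. exists (a + Rmin d (b - a) / 2).
    assert (0 < Rmin d (b - a)) by (apply Rmin_pos; lra).
    assert (L := Rmin_l d (b - a)). assert (L' := Rmin_r d (b - a)).
    split; [rewrite Rabs_pos_eq; lra|apply K; lra]. }
  rewrite (is_mean_unique _ _ _ _ Hm Ea).
  apply is_mean_limit; [lra|intros; apply Hc; lra|].
  intros d Hd'. exists (b - Rmin d (b - a) / 2).
  assert (0 < Rmin d (b - a)) by (apply Rmin_pos; lra).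
  assert (L := Rmin_l d (b - a)). assert (L' := Rmin_r d (b - a)).
  split; [rewrite Rabs_left; lra|apply K; lra].
Qed.

(** The origin and one circle are excepted from differentiability: across them
    the mean is carried by continuity. The exceptional circle is the one through
    the point where a slope function is only known to be continuous. *)
Lemma mean_value (f : C -> C) p r : 0 <= p < r ->
  (forall z, Cmod z <= r -> Ccts_at f z) ->
  (forall z, Cmod z <= r -> Cmod z <> 0 -> Cmod z <> p -> Cdiff f z) ->
  is_mean f r (f 0%C).
Proof.
intros Hp Hc Hd.
assert (H0 : is_mean f 0 (f 0%C)).
{ apply is_mean_ext with (fun _ => f 0%C); [lra| |apply is_mean_const].
  intros z Hz. apply Cmod_eq_0 in Hz. rewrite Hz; reflexivity. }
assert (Hp' : is_mean f p (f 0%C)).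
{ destruct (Req_dec p 0) as [->|N]; auto.
  apply is_mean_interval with 0; auto; [lra| |]; intros; [apply Hc|apply Hd]; lra. }
apply is_mean_interval with p; auto; intros; [apply Hc|apply Hd]; lra.
Qed.

Lemma mean_value_diff (f : C -> C) r : 0 < r ->
  (forall z, Cmod z <= r -> Cdiff f z) -> is_mean f r (f 0%C).
Proof. intros Hr H. apply mean_value with 0; [lra| |]; intros; auto. apply Cdiff_cts; auto. Qed.

Lemma Cmod_neq0 (z : C) : Cmod z <> 0 -> z <> 0%C.
Proof. intros H K; apply H; rewrite K; apply Cmod_0. Qed.

Lemma is_mean_monomial_ratio n m r : 0 < r -> n <> m ->
  is_mean (fun z => z ^ n / z ^ m)%C r 0%C.
Proof.
intros Hr Hnm. assert (P := PI_RGT_0).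
assert (Hk : INR n - INR m <> 0) by (intros K; apply Hnm, INR_eq; lra).
unfold is_mean.
replace (RtoC (2 * PI) * 0)%C with
 (r ^ n / r ^ m * ((cis ((INR n - INR m) * (2 * PI)) - cis ((INR n - INR m) * 0)) / (Ci * RtoC (INR n - INR m))))%C.
- apply is_CInt_ext with (fun t => r ^ n / r ^ m * cis ((INR n - INR m) * t))%C.
  + intros t _. assert (Nr : RtoC r <> 0%C) by (apply RtoC_neq0; lra).
    assert (Nc := cis_neq0 t).
    rewrite !Cpow_mult_l.
    replace (cis ((INR n - INR m) * t)) with (cis t ^ n / cis t ^ m)%C.
    * field. split; apply Cpow_nz; auto.
    * replace ((INR n - INR m) * t) with (INR n * t + - (INR m * t)) by ring.
      rewrite cis_plus, cis_opp, <- cis_inv, <- !cis_pow. reflexivity.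
  + apply is_CInt_scal. apply is_CInt_cis; auto.
- assert (E : forall k, cis (INR k * (2 * PI)) = 1%C).
  { intros k. rewrite <- cis_pow. replace (cis (2 * PI)) with (RtoC 1).
    - apply Cpow_1_l.
    - unfold cis. rewrite cos_2PI, sin_2PI; reflexivity. }
  rewrite Rmult_0_r.
  replace ((INR n - INR m) * (2 * PI)) with (INR n * (2 * PI) + - (INR m * (2 * PI))) by ring.
  rewrite cis_plus, cis_opp, !E.
  replace (cis 0) with (RtoC 1) by (unfold cis; rewrite cos_0, sin_0; reflexivity).
  replace (1 * Cconj 1 - 1)%C with (RtoC 0) by (Cext; ring).
  unfold Cdiv; ring.
Qed.

(** * Taylor expansion of complex differentiable functions *)

Lemma sum_n_S_C (u : nat -> C) n :
  sum_n (G := C_AbelianMonoid) u (S n) = (sum_n (G := C_AbelianMonoid) u n + u (S n))%C.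
Proof. exact (sum_Sn (G := C_AbelianMonoid) u n). Qed.

Definition disc_diff (f : C -> C) := forall z, Cmod z < 1 -> Cdiff f z.

Lemma coefficient_exists f n : disc_diff f ->
  exists c, forall r, 0 < r < 1 -> is_mean (fun z => f z / z ^ n)%C r c.
Proof.
intros Hf.
assert (D : forall z, 0 < Cmod z < 1 -> Cdiff (fun z => f z / z ^ n)%C z).
{ intros z Hz. assert (z <> 0%C) by (apply Cmod_neq0; lra).
  apply Cdiff_mult; [apply Hf; lra|].
  apply (Cdiff_comp Cinv (fun w => w ^ n)%C).
  - apply Cdiff_pow, Cdiff_id.
  - apply Cdiff_inv. apply Cpow_nz; auto. }
destruct (is_mean_exists (fun z => f z / z ^ n)%C (1/2)) as [c Hc].
- lra.
- intros z Hz. apply Cdiff_cts, D; lra.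
- exists c. intros r Hr. destruct (Rle_dec r (1 / 2)).
  + apply is_mean_annulus_inv with (1 / 2); auto; [lra|]. intros; apply D; lra.
  + apply is_mean_annulus with (1 / 2); auto; [lra|]. intros; apply D; lra.
Qed.

(** Asking for all radii at once is what [is_mean_annulus] provides, since
    [f z / z ^ n] is differentiable off the origin. *)
Definition is_taylor_coefs (f : C -> C) (c : nat -> C) :=
  forall n r, 0 < r < 1 -> is_mean (fun z => f z / z ^ n)%C r (c n).

Lemma taylor_coefs_exist f : disc_diff f -> exists c, is_taylor_coefs f c.
Proof.
intros Hf.
exists (fun n => proj1_sig (constructive_indefinite_description _ (coefficient_exists f n Hf))).
intros n. apply (proj2_sig (constructive_indefinite_description _ (coefficient_exists f n Hf))).
Qed.

(** Let [q] be the slope function of [f] at [z0] and [h z = z * q z]. Then [h] has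
    mean [h 0 = 0] on the circles beyond [z0]. From
    [h z = f z - f z0 + (z0 / z) * h z], iterated, the mean of [(z0 / z) ^ n * h z]
    is the error of the [n]-th partial sum at [z0], and it decays geometrically. *)
Lemma taylor f c : disc_diff f -> is_taylor_coefs f c -> power_series_on_disc c f.
Proof.
intros Hf Hc z0 Hz0. unfold in_disc in Hz0.
assert (P0 := Cmod_ge_0 z0).
destruct (Hf z0 Hz0) as [q [Hq Q]].
set (r := (Cmod z0 + 1) / 2). assert (Hr : Cmod z0 < r < 1) by (unfold r; lra).
assert (Dq : forall z, Cmod z < 1 -> z <> z0 -> Cdiff q z).
{ intros z Hz N.
  apply Cdiff_ext_loc with (fun w => (f w - f z0) * / (w - z0))%C.
  - apply locally_Cmod. exists (Cmod (z - z0)). split; [apply Cmod_gt_0, Cminus_neq0, N|].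
    intros w Hw. rewrite (Q w). field. apply Cminus_neq0.
    intros ->. rewrite <- Cmod_opp in Hw. replace (- (z0 - z))%C with (z - z0)%C in Hw by ring. lra.
  - apply Cdiff_mult.
    + apply Cdiff_minus; [apply Hf; auto|apply Cdiff_const].
    + apply (Cdiff_comp Cinv (fun w => w - z0)%C).
      * apply Cdiff_minus; [apply Cdiff_id|apply Cdiff_const].
      * apply Cdiff_inv, Cminus_neq0, N. }
assert (Cq : forall z, Cmod z < 1 -> Ccts_at q z).
{ intros z Hz. destruct (Ceq_dec z z0) as [->|N]; auto. apply Cdiff_cts; auto. }
pose (h := fun z => (z * q z)%C).
assert (Ch : forall z, Cmod z < 1 -> Ccts_at h z).
{ intros z Hz. apply Ccts_mult; [apply Ccts_id|auto]. }
assert (Mh : is_mean h r 0%C).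
{ replace (RtoC 0) with (h 0%C) by (unfold h; ring).
  apply mean_value with (Cmod z0).
  - lra.
  - intros; apply Ch; lra.
  - intros z Hz _ N. apply Cdiff_mult; [apply Cdiff_id|apply Dq; [lra|congruence]]. }
set (S_ := fun n => sum_n (G := C_AbelianMonoid) (fun k => z0 ^ k * c k)%C n).
assert (Rem : forall n, is_mean (fun z => z0 ^ S n / z ^ S n * h z)%C r (f z0 - S_ n)%C).
{ induction n.
  - replace (f z0 - S_ 0%nat)%C with (0 - (c 0%nat - f z0))%C
      by (unfold S_; rewrite sum_O; simpl; ring).
    apply is_mean_ext with (fun z => h z - (f z / z ^ 0 - f z0))%C; [lra| |].
    + intros z Hz. unfold h. rewrite (Q z). simpl. field. apply Cmod_neq0; lra.
    + apply is_mean_minus; [exact Mh|].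
      apply is_mean_minus; [apply Hc; lra|apply is_mean_const].
  - replace (f z0 - S_ (S n))%C with ((f z0 - S_ n) - z0 ^ S n * (c (S n) - f z0 * 0))%C
      by (unfold S_; rewrite sum_n_S_C; ring).
    apply is_mean_ext with (fun z => z0 ^ S n / z ^ S n * h z -
       z0 ^ S n * (f z / z ^ S n - f z0 * (z ^ 0 / z ^ S n)))%C; [lra| |].
    + intros z Hz. unfold h. rewrite (Q z). rewrite !Cpow_S. simpl (z ^ 0)%C. field.
      assert (z <> 0%C) by (apply Cmod_neq0; lra). split; auto. apply Cpow_nz; auto.
    + apply is_mean_minus; [exact IHn|].
      apply is_mean_scal. apply is_mean_minus; [apply Hc; lra|].
      apply is_mean_scal. apply is_mean_monomial_ratio; [lra|lia]. }
destruct (is_mean_exists (fun z => RtoC (Cmod (h z))) r) as [K HK].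
{ lra. }
{ intros z Hz. apply Ccts_RtoC, Ccts_Cmod, Ch; lra. }
assert (EK : K = RtoC (Re K)).
{ assert (E := is_mean_conj _ _ _ HK).
  apply (is_mean_ext _ (fun z => RtoC (Cmod (h z)))) in E; [|lra|intros; Cext; ring].
  assert (E2 := is_mean_unique _ _ _ _ HK E).
  assert (E3 : Im K = - Im K) by (rewrite E2 at 1; reflexivity).
  Cext; unfold Im, Re in *; lra. }
rewrite EK in HK. set (k := Re K) in HK.
assert (Bd : forall n, Cmod (f z0 - S_ n) <= (Cmod z0 / r) ^ S n * k).
{ intros n.
  apply is_mean_Cmod_le with (3 := Rem n) (g := fun z => (Cmod z0 / r) ^ S n * Cmod (h z)).
  - lra.
  - intros z Hz. assert (z <> 0%C) by (apply Cmod_neq0; lra).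
    rewrite Cmod_mult, Cmod_div by (apply Cpow_nz; auto).
    rewrite !Cmod_pow, Hz. unfold Rdiv. rewrite Rpow_mult_distr, pow_inv. apply Rle_refl.
  - rewrite RtoC_mult.
    apply is_mean_ext with (fun z => RtoC ((Cmod z0 / r) ^ S n) * RtoC (Cmod (h z)))%C.
    + lra.
    + intros; symmetry; apply RtoC_mult.
    + apply is_mean_scal; exact HK. }
apply (filterlim_ext S_).
{ intros n. unfold S_. apply sum_n_ext. intros j.
  change (z0 ^ j * c j = (pow_n (K := C_AbsRing) z0 j : C) * c j)%C. f_equal. }
intros P HP. apply locally_Cmod in HP. destruct HP as [e [He HP]].
assert (Hx : 0 <= Cmod z0 / r < 1).
{ split; [apply Rmult_le_pos; [lra|left; apply Rinv_0_lt_compat; lra]|].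
  apply Rmult_lt_reg_r with r; [lra|]. unfold Rdiv; rewrite Rmult_assoc, Rinv_l; lra. }
assert (Kk : 0 <= k).
{ change (Re (RtoC 0) <= Re (RtoC k)).
  apply is_mean_Re_le with (4 := HK) (f := fun _ => 0%C).
  - lra.
  - intros; simpl; apply Cmod_ge_0.
  - apply is_mean_const. }
destruct (pow_lt_1_zero (Cmod z0 / r)) with (y := e / (k + 1)) as [N HN].
{ rewrite Rabs_pos_eq; lra. }
{ apply Rdiv_lt_0_compat; lra. }
exists N. intros n Hn. apply HP.
rewrite <- Cmod_opp. replace (- (S_ n - f z0))%C with (f z0 - S_ n)%C by ring.
eapply Rle_lt_trans; [apply Bd|].
specialize (HN (S n) ltac:(lia)). rewrite Rabs_pos_eq in HN by (apply pow_le; lra).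
assert (P1 : 0 <= (Cmod z0 / r) ^ S n) by (apply pow_le; lra).
apply Rmult_lt_compat_r with (r := k + 1) in HN; [|lra].
unfold Rdiv at 2 in HN. rewrite Rmult_assoc, Rinv_l, Rmult_1_r in HN by lra. nra.
Qed.

(** * Bessel's inequality on circles *)

Definition sqmod (f : C -> C) (z : C) : C := RtoC (Cmod (f z) ^ 2).

(** Subtracting the component of [f] along a monomial lowers the mean square by
    the mean square of that component; on the circle the conjugate of [z ^ n] is
    [r ^ (2 n) / z ^ n]. *)
Lemma bessel_step f n d r k : 0 < r ->
  is_mean (fun z => f z / z ^ n)%C r d -> is_mean (sqmod f) r k ->
  is_mean (sqmod (fun z => f z - d * z ^ n)%C) r (k - RtoC (Cmod d ^ 2 * (r ^ n) ^ 2))%C.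
Proof.
intros Hr Hd Hk.
replace (k - RtoC (Cmod d ^ 2 * (r ^ n) ^ 2))%C with
 (k - (d * (RtoC ((r ^ n) ^ 2) * Cconj d) + Cconj d * (RtoC ((r ^ n) ^ 2) * d))
    + RtoC (Cmod d ^ 2 * (r ^ n) ^ 2))%C.
2:{ rewrite RtoC_mult, Cmod2_conj. ring. }
apply is_mean_ext with (fun z => sqmod f z -
   (d * (RtoC ((r ^ n) ^ 2) * Cconj (f z / z ^ n)) + Cconj d * (RtoC ((r ^ n) ^ 2) * (f z / z ^ n)))
   + RtoC (Cmod d ^ 2 * (r ^ n) ^ 2))%C.
- lra.
- intros z Hz. assert (N : z <> 0%C) by (apply Cmod_neq0; lra).
  unfold sqmod. rewrite RtoC_mult, !Cmod2_conj.
  assert (Nn := Cpow_nz z n N).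
  assert (E : RtoC ((r ^ n) ^ 2) = (z ^ n * Cconj (z ^ n))%C).
  { rewrite <- Cmod2_conj, Cmod_pow, Hz. reflexivity. }
  rewrite E, Cdiv_conj, Cminus_conj, Cmult_conj by auto.
  field. split; auto.
  intros K. apply Nn. rewrite <- (Cconj_conj (z ^ n)), K. Cext; ring.
- apply is_mean_plus; [|apply is_mean_const].
  apply is_mean_minus; auto. apply is_mean_plus; do 2 apply is_mean_scal; auto.
  apply is_mean_conj; auto.
Qed.

Lemma Bessel f c r k : 0 < r ->
  (forall n, is_mean (fun z => f z / z ^ n)%C r (c n)) -> is_mean (sqmod f) r k ->
  forall N, sum_n (fun n => Cmod (c n) ^ 2 * (r ^ n) ^ 2) N <= Re k.
Proof.
intros Hr Hc Hk N.
pose (T := fun N => sum_n (fun n => Cmod (c n) ^ 2 * (r ^ n) ^ 2) N).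
change (T N <= Re k).
assert (S_ : forall N, exists g,
  is_mean (sqmod g) r (k - RtoC (T N)) /\
  forall m, (N < m)%nat -> is_mean (fun z => g z / z ^ m)%C r (c m)).
{ assert (O_ : forall g d n m, n <> m -> is_mean (fun z => g z / z ^ m)%C r (c m) ->
     is_mean (fun z => (g z - d * z ^ n) / z ^ m)%C r (c m)).
  { intros g d n m Hnm H. replace (c m) with (c m - d * 0)%C by ring.
    apply is_mean_ext with (fun z => g z / z ^ m - d * (z ^ n / z ^ m))%C.
    - lra.
    - intros; unfold Cdiv; ring.
    - apply is_mean_minus; auto. apply is_mean_scal, is_mean_monomial_ratio; auto. }
  clear N. induction N as [|N [g [G1 G2]]].
  - exists (fun z => f z - c O * z ^ O)%C. split.
    + unfold T; rewrite sum_O. apply bessel_step; auto.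
    + intros m Hm. apply O_; [lia|auto].
  - exists (fun z => g z - c (S N) * z ^ S N)%C. split.
    + replace (T (S N)) with (T N + Cmod (c (S N)) ^ 2 * (r ^ S N) ^ 2)
        by (unfold T; rewrite sum_Sn; reflexivity).
      rewrite RtoC_plus.
      replace (k - (RtoC (T N) + RtoC (Cmod (c (S N)) ^ 2 * (r ^ S N) ^ 2)%R))%C
        with ((k - RtoC (T N)) - RtoC (Cmod (c (S N)) ^ 2 * (r ^ S N) ^ 2)%R)%C by ring.
      apply bessel_step; auto.
    + intros m Hm. apply O_; [lia|]. apply G2; lia. }
destruct (S_ N) as [g [G _]].
assert (E : Re 0%C <= Re (k - RtoC (T N))).
{ apply is_mean_Re_le with (4 := G) (f := fun _ => 0%C).
  - lra.
  - intros; unfold sqmod, Re; simpl fst. apply pow2_ge_0.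
  - apply is_mean_const. }
unfold Re in E |- *. simpl in E. lra.
Qed.

(** * A harmonic majorant with prescribed value at a point *)

Fixpoint peval (l : list C) (w : C) : C :=
  match l with [] => 0%C | b :: l' => (b + w * peval l' w)%C end.

Fixpoint sqsum (l : list C) : R :=
  match l with [] => 0 | b :: l' => Cmod b ^ 2 + sqsum l' end.

(** Twice the analytic part, minus the constant term, of the trigonometric
    polynomial [|p|^2] on the unit circle, [p] being the polynomial with
    coefficients [l]: its real part is the Poisson extension of [|p|^2]. *)
Fixpoint majorant (l : list C) (w : C) : C :=
  match l with
  | [] => 0%C
  | b :: l' => (RtoC (Cmod b ^ 2) + 2 * (Cconj b * (w * peval l' w)) + majorant l' w)%C
  end.

(** The proper tails of [l] are the coefficients of the iterated backward shifts
    of the polynomial. *)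
Fixpoint tails_sq (l : list C) (w : C) : R :=
  match l with [] => 0 | _ :: l' => Cmod (peval l' w) ^ 2 + tails_sq l' w end.

(** Multiplication by [1 - Cconj a * w] on coefficients; [p] is the coefficient
    that precedes [l], so the product proper has [p = 0]. *)
Fixpoint mul_kernel (a p : C) (l : list C) : list C :=
  match l with
  | [] => [(- (Cconj a * p))%C]
  | b :: l' => (b - Cconj a * p)%C :: mul_kernel a b l'
  end.

(** An explicit form of the subharmonicity of the squared modulus: the excess of
    the Poisson extension over it is visibly nonnegative on the disc. *)
Lemma Re_majorant l w :
  Re (majorant l w) = Cmod (peval l w) ^ 2 + (1 - Cmod w ^ 2) * tails_sq l w.
Proof.
induction l as [|b l IH]; cbn [majorant peval tails_sq].
- rewrite Cmod_0; simpl; ring.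
- rewrite !Cmod2_alt in IH. rewrite !Cmod2_alt. unfold Re, Im in *. simpl in *. rewrite IH. ring.
Qed.

Lemma tails_sq_ge0 l w : 0 <= tails_sq l w.
Proof.
induction l; simpl; [lra|]. assert (0 <= Cmod (peval l w) ^ 2) by apply pow2_ge_0.
simpl in *; lra.
Qed.

Lemma peval_le_majorant l w : Cmod w <= 1 -> Cmod (peval l w) ^ 2 <= Re (majorant l w).
Proof.
intros H. rewrite Re_majorant. assert (T := tails_sq_ge0 l w).
assert (C0 := Cmod_ge_0 w). assert (Cmod w ^ 2 <= 1) by nra. nra.
Qed.

Lemma peval_mul_kernel a l p w :
  peval (mul_kernel a p l) w = ((1 - Cconj a * w) * peval l w - Cconj a * p)%C.
Proof.
revert p; induction l as [|b l IH]; intros p; simpl; [ring|]. rewrite IH. ring.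
Qed.

(** With [x] and [y] consecutive backward shifts of [l] at [a], so that
    [y = b + a * x], one has
    [|x - Cconj a * y|^2 = |b|^2 + (1 - |a|^2) * (|x|^2 - |y|^2)], and the sum
    telescopes. The first coefficient is never part of a proper tail, whence the
    independence of [p]. *)
Lemma tails_sq_mul_kernel a l p :
  tails_sq (mul_kernel a p l) a = sqsum l - (1 - Cmod a ^ 2) * Cmod (peval l a) ^ 2.
Proof.
revert p; induction l as [|b l IH]; intros p; cbn [mul_kernel tails_sq sqsum peval].
- rewrite Cmod_0; simpl; ring.
- rewrite IH, peval_mul_kernel. rewrite !Cmod2_alt. unfold Re, Im; simpl. ring.
Qed.

(** The Poisson kernel at [a] is [(1 - |a|^2) / |1 - Cconj a * w|^2] on the unit
    circle. It cancels the factor of [mul_kernel], leaving the mean of the squared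
    modulus of the polynomial. *)
Lemma majorant_mul_kernel a l :
  Re (majorant (mul_kernel a 0%C l) a) = (1 - Cmod a ^ 2) * sqsum l.
Proof.
rewrite Re_majorant, tails_sq_mul_kernel, peval_mul_kernel.
rewrite !Cmod2_alt. unfold Re, Im; simpl. ring.
Qed.

Lemma Cdiff_peval l f z : Cdiff f z -> Cdiff (fun w => peval l (f w)) z.
Proof.
intros H; induction l; simpl; [apply Cdiff_const|].
apply Cdiff_plus; [apply Cdiff_const|apply Cdiff_mult; auto].
Qed.

Lemma Cdiff_majorant l f z : Cdiff f z -> Cdiff (fun w => majorant l (f w)) z.
Proof.
intros H; induction l; simpl; [apply Cdiff_const|].
apply Cdiff_plus; auto. apply Cdiff_plus; [apply Cdiff_const|].
do 2 (apply Cdiff_mult; [apply Cdiff_const|]).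
apply Cdiff_mult; auto. apply Cdiff_peval; auto.
Qed.

(** * Partial sums of power series *)

Definition coef_list (b : nat -> C) (N : nat) : list C := map b (seq 0 N).

Lemma peval_app l m w : peval (l ++ m) w = (peval l w + w ^ length l * peval m w)%C.
Proof. induction l; simpl; [ring|]. rewrite IHl; ring. Qed.

Lemma sqsum_app l m : sqsum (l ++ m) = sqsum l + sqsum m.
Proof. induction l; simpl; [ring|]. rewrite IHl; ring. Qed.

Lemma coef_list_S b N : coef_list b (S N) = coef_list b N ++ [b N].
Proof. unfold coef_list. rewrite seq_S, map_app. reflexivity. Qed.

Lemma coef_list_length b N : length (coef_list b N) = N.
Proof. unfold coef_list. rewrite length_map, length_seq. reflexivity. Qed.

Lemma sqsum_coef_list b N : sqsum (coef_list b (S N)) = sum_n (fun n => Cmod (b n) ^ 2) N.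
Proof.
induction N.
- rewrite sum_O. unfold coef_list; simpl. ring.
- rewrite coef_list_S, sqsum_app, IHN, sum_Sn. simpl sqsum. rewrite Rplus_0_r. reflexivity.
Qed.

Lemma peval_coef_list b N w :
  peval (coef_list b (S N)) w = sum_n (G := C_AbelianMonoid) (fun n => b n * w ^ n)%C N.
Proof.
induction N.
- rewrite sum_O. unfold coef_list; simpl. ring.
- rewrite coef_list_S, peval_app, IHN, sum_n_S_C, coef_list_length. simpl peval. ring.
Qed.

Lemma series_partial_le (u : nat -> R) l N :
  (forall n, 0 <= u n) -> is_series u l -> sum_n u N <= l.
Proof.
intros Hu Hl.
apply (is_lim_seq_incr_compare (sum_n u) l); [exact Hl|].
intros n. rewrite sum_Sn. assert (H := Hu (S n)). unfold plus; simpl; lra.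
Qed.

(** The constant 2 bounds the coefficients of functions of norm at most 2,
    which covers norms slightly above 1; the rest is a geometric series. *)
Lemma tail_bound f b s w N : 0 <= s < 1 -> Cmod w <= s ->
  (forall n, Cmod (b n) <= 2) -> power_series_on_disc b f ->
  Cmod (f w - peval (coef_list b (S N)) w) <= 2 * s ^ N / (1 - s).
Proof.
intros Hs Hw Hb Hf.
assert (Diff : forall m, Cmod (peval (coef_list b (S (m + N))) w - peval (coef_list b (S N)) w)
   <= 2 * (s ^ N - s ^ (m + N)) / (1 - s)).
{ induction m; cbn [Nat.add].
  - replace (_ - _)%C with (RtoC 0) by ring. rewrite Cmod_0. right; field; lra.
  - rewrite coef_list_S, peval_app, coef_list_length.
    set (x := peval (coef_list b (S (m + N))) w) in *. set (y := peval (coef_list b (S N)) w) in *.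
    simpl peval.
    replace (x + w ^ S (m + N) * (b (S (m + N)) + w * 0) - y)%C with
      ((x - y) + w ^ S (m + N) * b (S (m + N))%nat)%C by ring.
    eapply Rle_trans; [apply Cmod_triangle|].
    rewrite Cmod_mult, Cmod_pow.
    assert (K : Cmod w ^ S (m + N) * Cmod (b (S (m + N))) <= s ^ (m + N) * 2).
    { apply Rmult_le_compat; auto; try apply Cmod_ge_0; [apply pow_le, Cmod_ge_0|].
      simpl. assert (0 <= Cmod w) by apply Cmod_ge_0.
      assert (Cmod w ^ (m + N) <= s ^ (m + N)) by (apply pow_incr; lra).
      assert (0 <= Cmod w ^ (m + N)) by (apply pow_le; lra). nra. }
    replace (2 * (s ^ N - s ^ S (m + N)) / (1 - s)) with
      (2 * (s ^ N - s ^ (m + N)) / (1 - s) + s ^ (m + N) * 2) by (simpl; field; lra).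
    lra. }
assert (Diff2 : forall m, Cmod (peval (coef_list b (S (m + N))) w - peval (coef_list b (S N)) w)
   <= 2 * s ^ N / (1 - s)).
{ intros m. eapply Rle_trans; [apply Diff|].
  apply Rmult_le_compat_r; [left; apply Rinv_0_lt_compat; lra|].
  assert (0 <= s ^ (m + N)) by (apply pow_le; lra). lra. }
apply le_epsilon. intros e He.
assert (L : locally (T := C_UniformSpace) (f w) (fun y => Cmod (y - f w) < e))
  by (apply locally_Cmod; exists e; auto).
assert (Hd : in_disc w) by (unfold in_disc; lra).
destruct (Hf w Hd _ L) as [M HM].
specialize (HM (M + N)%nat ltac:(lia)).
match type of HM with Cmod (?x - _) < e => assert (E : x = peval (coef_list b (S (M + N))) w) end.
{ rewrite peval_coef_list. apply sum_n_ext. intros k.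
  change ((pow_n (K := C_AbsRing) w k : C) * b k = b k * w ^ k)%C.
  change (w ^ k * b k = b k * w ^ k)%C. ring. }
rewrite E in HM.
set (x := peval (coef_list b (S (M + N))) w) in *.
replace (f w - peval (coef_list b (S N)) w)%C with
  (- (x - f w) + (x - peval (coef_list b (S N)) w))%C by ring.
eapply Rle_trans; [apply Cmod_triangle|]. rewrite Cmod_opp.
specialize (Diff2 M). fold x in Diff2. lra.
Qed.

(** * The norm estimate *)

Lemma Rsq_add_le x y eta : 0 < eta -> (x + y) ^ 2 <= (1 + eta) * x ^ 2 + (1 + / eta) * y ^ 2.
Proof.
intros H.
assert (E : (1 + eta) * x ^ 2 + (1 + / eta) * y ^ 2 - (x + y) ^ 2 = / eta * (eta * x - y) ^ 2)
  by (field; lra).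
assert (0 <= / eta * (eta * x - y) ^ 2).
{ apply Rmult_le_pos; [left; apply Rinv_0_lt_compat; lra|apply pow2_ge_0]. }
lra.
Qed.

(** The heart of the matter. For a partial sum [p] of [f], the square of
    [|p| * |1 - Cconj a * w|] is dominated by the real part of a polynomial; composed
    with [phi], the latter has as circle mean its value at [a = phi 0], which
    [majorant_mul_kernel] computes. The factor [M] compensates for the kernel. *)
Lemma mean_comp_bound phi f b (s M S0 r : R) k :
  disc_diff phi -> 0 <= s < 1 -> (forall z, Cmod z < 1 -> Cmod (phi z) <= s) ->
  0 <= M ->
  (forall z, Cmod z < 1 ->
     sqrt (1 - Cmod (phi 0%C) ^ 2) <= M * Cmod (1 - Cconj (phi 0%C) * phi z)) ->
  power_series_on_disc b f -> is_series (fun n => Cmod (b n) ^ 2) S0 -> S0 <= 4 ->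
  0 < r < 1 ->
  is_mean (sqmod (fun z => f (phi z))) r k -> Re k <= M ^ 2 * S0.
Proof.
intros Dphi Hs Hphi HM HMk Hf HS HS4 Hr Hk.
set (a := phi 0%C) in *.
assert (Ha : Cmod a <= s) by (apply Hphi; rewrite Cmod_0; lra).
assert (Ca := Cmod_ge_0 a).
assert (Hka : 0 < 1 - Cmod a ^ 2) by nra.
set (ka := 1 - Cmod a ^ 2) in *.
assert (Sq : sqrt ka ^ 2 = ka) by (rewrite <- (Rsqr_pow2 (sqrt ka)); apply Rsqr_sqrt; lra).
assert (Sp : 0 < sqrt ka) by (apply sqrt_lt_R0; auto).
assert (Part : forall N, sqsum (coef_list b (S N)) <= S0).
{ intros N. rewrite sqsum_coef_list. apply series_partial_le; auto. intros; apply pow2_ge_0. }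
assert (Hb : forall n, Cmod (b n) <= 2).
{ intros n. assert (P := Part n). rewrite coef_list_S, sqsum_app in P. simpl in P.
  assert (0 <= sqsum (coef_list b n)).
  { generalize (coef_list b n). intros l; induction l; simpl; [lra|].
    assert (0 <= Cmod a0 ^ 2) by apply pow2_ge_0. simpl in *; lra. }
  assert (C0 := Cmod_ge_0 (b n)). nra. }
assert (S0pos : 0 <= S0).
{ apply Rle_trans with (2 := Part O). unfold coef_list; simpl.
  assert (0 <= Cmod (b O) ^ 2) by apply pow2_ge_0. simpl in *; lra. }
(* [f] is replaced by its partial sum at the price of the term with [s ^ N];
   [eta] absorbs the cross term of the square. *)
assert (Key : forall eta N, 0 < eta ->
   Re k <= M ^ 2 / ka * ((1 + eta) * (ka * S0) + (1 + / eta) * (4 * s ^ N / (1 - s)) ^ 2)).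
{ intros eta N Heta.
  set (l := mul_kernel a 0%C (coef_list b (S N))).
  set (E := (1 + / eta) * (4 * s ^ N / (1 - s)) ^ 2).
  assert (Mean : is_mean (fun z => RtoC (M ^ 2 / ka) * (RtoC (1 + eta) * majorant l (phi z) + RtoC E))%C r
     (RtoC (M ^ 2 / ka) * (RtoC (1 + eta) * majorant l a + RtoC E))%C).
  { apply is_mean_scal, is_mean_plus; [|apply is_mean_const]. apply is_mean_scal.
    apply (mean_value_diff (fun z => majorant l (phi z))); [lra|].
    intros z Hz. apply Cdiff_majorant, Dphi; lra. }
  assert (Le : Re k <= Re (RtoC (M ^ 2 / ka) * (RtoC (1 + eta) * majorant l a + RtoC E))%C).
  { apply is_mean_Re_le with (3 := Hk) (4 := Mean); [lra|].
    intros z Hz.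
    set (w := phi z) in *. assert (Hw : Cmod w <= s) by (apply Hphi; lra).
    assert (Kz := HMk z ltac:(lra)). fold w in Kz.
    set (K := (1 - Cconj a * w)%C) in *.
    assert (CK := Cmod_ge_0 K). assert (Cf := Cmod_ge_0 (f w)).
    assert (K2 : Cmod K <= 2).
    { unfold K, Cminus. eapply Rle_trans; [apply Cmod_triangle|].
      rewrite Cmod_1, Cmod_opp, Cmod_mult, Cmod_conj.
      assert (Cw := Cmod_ge_0 w). nra. }
    assert (Maj := peval_le_majorant l w ltac:(lra)).
    unfold l in Maj at 1. rewrite peval_mul_kernel in Maj. fold K in Maj.
    replace (K * peval (coef_list b (S N)) w - Cconj a * 0)%C with
       (K * peval (coef_list b (S N)) w)%C in Maj by ring.
    assert (T := tail_bound f b s w N Hs Hw Hb Hf).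
    set (p := peval (coef_list b (S N)) w) in *.
    assert (F1 : Cmod (f w) * Cmod K <= Cmod (K * p) + 4 * s ^ N / (1 - s)).
    { rewrite <- Cmod_mult.
      replace (f w * K)%C with (K * p + K * (f w - p))%C by ring.
      eapply Rle_trans; [apply Cmod_triangle|]. apply Rplus_le_compat_l.
      rewrite Cmod_mult.
      replace (4 * s ^ N / (1 - s)) with (2 * (2 * s ^ N / (1 - s))) by (field; lra).
      apply Rmult_le_compat; auto; apply Cmod_ge_0. }
    assert (F2 : (Cmod (f w) * Cmod K) ^ 2 <= (1 + eta) * Re (majorant l w) + E).
    { apply Rle_trans with ((Cmod (K * p) + 4 * s ^ N / (1 - s)) ^ 2).
      - apply pow_incr; split; auto. apply Rmult_le_pos; auto.
      - eapply Rle_trans; [apply (Rsq_add_le _ _ eta Heta)|]. unfold E.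
        apply Rplus_le_compat_r. apply Rmult_le_compat_l; auto; lra. }
    assert (F3 : ka * Cmod (f w) ^ 2 <= M ^ 2 * (Cmod (f w) * Cmod K) ^ 2).
    { replace (M ^ 2 * (Cmod (f w) * Cmod K) ^ 2) with ((M * Cmod K) ^ 2 * Cmod (f w) ^ 2) by ring.
      apply Rmult_le_compat_r; [apply pow2_ge_0|]. rewrite <- Sq. apply pow_incr; lra. }
    replace (Re _) with (Cmod (f w) ^ 2) by reflexivity.
    replace (Re _) with (M ^ 2 / ka * ((1 + eta) * Re (majorant l w) + E))
      by (unfold Re; simpl; fold w; field; lra).
    apply Rmult_le_reg_l with ka; auto.
    replace (ka * (M ^ 2 / ka * ((1 + eta) * Re (majorant l w) + E))) with
       (M ^ 2 * ((1 + eta) * Re (majorant l w) + E)) by (field; lra).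
    eapply Rle_trans; [exact F3|]. apply Rmult_le_compat_l; auto. apply pow2_ge_0. }
  replace (Re (_ * _)%C) with (M ^ 2 / ka * ((1 + eta) * Re (majorant l a) + E)) in Le
    by (unfold Re; simpl; field; lra).
  eapply Rle_trans; [exact Le|].
  assert (0 <= M ^ 2 / ka).
  { apply Rmult_le_pos; [apply pow2_ge_0|left; apply Rinv_0_lt_compat; auto]. }
  apply Rmult_le_compat_l; auto. apply Rplus_le_compat_r, Rmult_le_compat_l; [lra|].
  unfold l. rewrite majorant_mul_kernel. fold ka. apply Rmult_le_compat_l; [lra|auto]. }
(* The truncation error vanishes as [N] grows, because [s < 1]. *)
assert (Key2 : forall eta, 0 < eta -> Re k <= M ^ 2 * ((1 + eta) * S0)).
{ intros eta Heta.
  assert (L : is_lim_seq (fun N => M ^ 2 / ka * ((1 + eta) * (ka * S0) + (1 + / eta) * (4 * s ^ N / (1 - s)) ^ 2))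
     (M ^ 2 / ka * ((1 + eta) * (ka * S0) + (1 + / eta) * (4 * 0 / (1 - s)) ^ 2))).
  { refine (is_lim_seq_continuous (fun x => M ^ 2 / ka * ((1 + eta) * (ka * S0) + (1 + / eta) * (4 * x / (1 - s)) ^ 2))
      (fun N => s ^ N) 0 _ _).
    - apply derivable_continuous_pt, ex_derive_Reals_0. auto_derive; auto.
    - apply is_lim_seq_geom. rewrite Rabs_pos_eq; lra. }
  assert (R_ := is_lim_seq_le (fun _ => Re k) _ (Re k) _ (fun N => Key eta N Heta) (is_lim_seq_const _) L).
  simpl in R_.
  eapply Rle_trans; [exact R_|]. right. field. lra. }
apply le_epsilon. intros e He.
assert (HX : 0 <= M ^ 2 * S0) by (apply Rmult_le_pos; auto; apply pow2_ge_0).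
set (X := M ^ 2 * S0) in *.
specialize (Key2 (e / (X + 1)) ltac:(apply Rdiv_lt_0_compat; lra)).
eapply Rle_trans; [exact Key2|].
replace (M ^ 2 * ((1 + e / (X + 1)) * S0)) with (X + e * (X / (X + 1))) by (unfold X; field; fold X; lra).
apply Rplus_le_compat_l. rewrite <- (Rmult_1_r e) at 2. apply Rmult_le_compat_l; [lra|].
apply Rmult_le_reg_r with (X + 1); [lra|]. unfold Rdiv; rewrite Rmult_assoc, Rinv_l; lra.
Qed.

Lemma disc_diff_of_analytic f : analytic_on_disc f -> disc_diff f.
Proof. intros H z Hz. apply Cdiff_of_ex_derive, H, Hz. Qed.

(** The weights are at least [(r ^ N) ^ 2], which tends to 1 with [r]. *)
Lemma sum_bound_radius_one (u : nat -> R) N K : (forall n, 0 <= u n) ->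
  (forall r, 0 < r < 1 -> sum_n (fun n => u n * (r ^ n) ^ 2) N <= K) -> sum_n u N <= K.
Proof.
intros Hu H.
assert (L : forall r, 0 < r < 1 -> (r ^ N) ^ 2 * sum_n u N <= K).
{ intros r Hr. eapply Rle_trans; [|apply (H r Hr)].
  assert (Hpow : forall m, (m <= N)%nat -> 0 <= r ^ N <= r ^ m).
  { intros m Hm. split; [apply pow_le; lra|].
    replace N with (m + (N - m))%nat by lia. rewrite pow_add.
    assert (0 <= r ^ m) by (apply pow_le; lra).
    assert (r ^ (N - m) <= 1) by (rewrite <- (pow1 (N - m)); apply pow_incr; lra).
    nra. }
  assert (G : forall m, (m <= N)%nat ->
     (r ^ N) ^ 2 * sum_n u m <= sum_n (fun n => u n * (r ^ n) ^ 2) m); [|apply G; lia].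
  assert (T : forall m, (m <= N)%nat -> (r ^ N) ^ 2 * u m <= u m * (r ^ m) ^ 2).
  { intros m Hm. rewrite Rmult_comm. apply Rmult_le_compat_l; auto. apply pow_incr; auto. }
  induction m as [|m IH]; intros Hm.
  - rewrite !sum_O. apply T; lia.
  - rewrite !sum_Sn. specialize (IH ltac:(lia)). specialize (T (S m) Hm).
    unfold plus; cbn [AbelianMonoid.plus AbelianMonoid.class] in *. simpl in *. lra. }
assert (Lim : is_lim_seq (fun j => (((1 - (/ 2) ^ S j) ^ N) ^ 2) * sum_n u N)
   (((1 - 0) ^ N) ^ 2 * sum_n u N)).
{ refine (is_lim_seq_continuous (fun x => ((1 - x) ^ N) ^ 2 * sum_n u N)
      (fun j => (/ 2) ^ S j) 0 _ _).
  - apply derivable_continuous_pt, ex_derive_Reals_0. auto_derive; auto.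
  - apply (is_lim_seq_incr_1 (fun j => (/ 2) ^ j)).
    apply is_lim_seq_geom. rewrite Rabs_pos_eq; lra. }
assert (E : (((1 - 0) ^ N) ^ 2 * sum_n u N) <= K).
{ apply (is_lim_seq_le _ _ _ K) with (2 := Lim) (3 := is_lim_seq_const _).
  intros j. apply L. simpl.
  assert (0 < (/ 2) ^ j) by (apply pow_lt; lra).
  assert ((/ 2) ^ j <= 1) by (rewrite <- (pow1 j); apply pow_incr; lra). lra. }
rewrite Rminus_0_r, pow1, pow1, Rmult_1_l in E. exact E.
Qed.

(** An infimum need not be attained, hence the margin [del]. *)
Lemma H2_norm_le_rep f del : Rbar_le (H2_norm f) 1 -> 0 < del ->
  exists b S0, power_series_on_disc b f /\ is_series (fun n => (Cmod (b n) ^ 2)%R) S0 /\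
    S0 <= (1 + del) ^ 2.
Proof.
intros Hf Hdel.
destruct (excluded_middle_informative (exists r, is_H2_norm f r /\ r < 1 + del)) as [[r [[b [B1 [B2 B3]]] Hr]]|N].
- exists b, (r ^ 2). repeat split; auto. apply pow_incr; lra.
- exfalso.
  destruct (Glb_Rbar_correct (is_H2_norm f)) as [_ G].
  assert (K : Rbar_le (1 + del) (Glb_Rbar (is_H2_norm f))).
  { apply G. intros r Hr. simpl. apply Rnot_lt_le. intros L. apply N; exists r; auto. }
  assert (K2 := Rbar_le_trans _ _ _ K Hf). simpl in K2. lra.
Qed.

(** Bessel's inequality bounds the Taylor coefficients of [f] composed with [phi]
    by its mean squares on circles, which [mean_comp_bound] controls. *)
Lemma comp_norm_le phi f s M :
  disc_diff phi -> 0 <= s < 1 -> (forall z, Cmod z < 1 -> Cmod (phi z) <= s) ->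
  0 <= M ->
  (forall z, Cmod z < 1 ->
     sqrt (1 - Cmod (phi 0%C) ^ 2) <= M * Cmod (1 - Cconj (phi 0%C) * phi z)) ->
  disc_diff f -> Rbar_le (H2_norm f) 1 -> Rbar_le (H2_norm (comp_op phi f)) M.
Proof.
intros Dphi Hs Hphi HM HMk Df Hf.
assert (Dg : disc_diff (comp_op phi f)).
{ intros z Hz. apply (Cdiff_comp f phi); [apply Dphi, Hz|]. apply Df.
  apply Rle_lt_trans with s; [apply Hphi, Hz|lra]. }
destruct (taylor_coefs_exist _ Dg) as [c Hc].
assert (Pc := taylor _ _ Dg Hc).
assert (Sum : forall N, sum_n (fun n => Cmod (c n) ^ 2) N <= M ^ 2).
{ intros N. apply sum_bound_radius_one; [intros; apply pow2_ge_0|].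
  intros r Hr.
  destruct (is_mean_exists (sqmod (comp_op phi f)) r) as [k Hk].
  { lra. }
  { intros z Hz. unfold sqmod. apply Ccts_RtoC. simpl.
    assert (Ccts_at (comp_op phi f) z) by (apply Cdiff_cts, Dg; lra).
    repeat apply @continuous_mult; try apply Ccts_Cmod; auto. apply continuous_const. }
  apply Rle_trans with (Re k).
  { apply (Bessel (comp_op phi f) c r k); [lra|intros n; apply Hc, Hr|exact Hk]. }
  apply le_epsilon. intros e He.
  assert (HM2 := pow2_ge_0 M).
  set (del := Rmin 1 (e / (3 * (M ^ 2 + 1)))).
  assert (Hdel : 0 < del <= 1).
  { split; [apply Rmin_pos; [lra|apply Rdiv_lt_0_compat; lra]|apply Rmin_l]. }
  assert (Hdel2 : del * (3 * (M ^ 2 + 1)) <= e).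
  { apply Rle_trans with (e / (3 * (M ^ 2 + 1)) * (3 * (M ^ 2 + 1))).
    - apply Rmult_le_compat_r; [lra|apply Rmin_r].
    - right; field; lra. }
  destruct (H2_norm_le_rep f del Hf ltac:(lra)) as [b [S0 [Hb [HS HS0]]]].
  assert (B := mean_comp_bound phi f b s M S0 r k Dphi Hs Hphi HM HMk Hb HS ltac:(nra) Hr Hk).
  eapply Rle_trans; [exact B|].
  apply Rle_trans with (M ^ 2 * (1 + 3 * del)); [apply Rmult_le_compat_l; nra|nra]. }
destruct (ex_finite_lim_seq_incr (sum_n (fun n => Cmod (c n) ^ 2)) (M ^ 2)) as [l Hl].
{ intros n. rewrite sum_Sn. assert (H := pow2_ge_0 (Cmod (c (S n)))). unfold plus; simpl in *; lra. }
{ exact Sum. }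
assert (Hl2 : l <= M ^ 2).
{ apply (is_lim_seq_le _ _ l (M ^ 2) Sum Hl (is_lim_seq_const _)). }
assert (Hl0 : 0 <= l).
{ apply (is_lim_seq_le (fun _ => 0) _ 0 l) with (2 := is_lim_seq_const _) (3 := Hl).
  intros n; induction n; [rewrite sum_O; apply pow2_ge_0|].
  rewrite sum_Sn. assert (H := pow2_ge_0 (Cmod (c (S n)))). unfold plus; simpl in *; lra. }
apply Rbar_le_trans with (sqrt l).
- destruct (Glb_Rbar_correct (is_H2_norm (comp_op phi f))) as [G _]. apply G.
  exists c. split; [exact Pc|]. split; [|apply sqrt_pos].
  replace (sqrt l ^ 2) with l; [exact Hl|]. rewrite <- (Rsqr_pow2 (sqrt l)), Rsqr_sqrt; auto.
- simpl. rewrite <- (sqrt_pow2 M HM). apply sqrt_le_1_alt. exact Hl2.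
Qed.

Lemma sup_norm_finite psi B : (forall z, in_disc z -> Cmod (psi z) <= B) ->
  exists M, sup_norm psi = Finite M /\ 0 <= M <= B /\ forall z, in_disc z -> Cmod (psi z) <= M.
Proof.
intros HB.
assert (D0 : in_disc 0%C) by (unfold in_disc; rewrite Cmod_0; lra).
unfold sup_norm. set (E := fun r : R => exists z : C, in_disc z /\ r = Cmod (psi z)).
destruct (Lub_Rbar_correct E) as [U L].
assert (L' : Rbar_le (Lub_Rbar E) B).
{ apply L. intros r [z [Hz Er]]. rewrite Er. apply HB, Hz. }
assert (U0 : Rbar_le (Cmod (psi 0%C)) (Lub_Rbar E)) by (apply U; exists 0%C; auto).
assert (C0 := Cmod_ge_0 (psi 0%C)).
destruct (Lub_Rbar E) as [M| |]; simpl in L', U0; try contradiction.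
exists M. split; auto. split; [lra|].
intros z Hz. apply (U (Cmod (psi z))). exists z; auto.
Qed.

Open Scope C_scope.

Theorem theorem3p1 (phi : C -> C)
  (phi_analytic : analytic_on_disc phi)
  (phi_self_map : forall z : C, in_disc z -> in_disc (phi z))
  (phi0_neq0 : phi (RtoC 0) <> RtoC 0)
  (phi_sup_lt1 : Rbar_lt (sup_norm phi) (Finite 1%R)) :
  Rbar_le (op_norm (comp_op phi))
    (sup_norm (fun z =>
       RtoC (sqrt (1 - Cmod (phi (RtoC 0)) ^ 2)%R) /
       (RtoC 1 - Cconj (phi (RtoC 0)) * phi z)))
  /\
  Rbar_lt
    (sup_norm (fun z =>
       RtoC (sqrt (1 - Cmod (phi (RtoC 0)) ^ 2)%R) /
       (RtoC 1 - Cconj (phi (RtoC 0)) * phi z)))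
    (Finite (sqrt ((1 + Cmod (phi (RtoC 0))) / (1 - Cmod (phi (RtoC 0))))%R)).
Proof.
destruct (sup_norm_finite phi 1) as [s [Es [Hs Hphi]]].
{ intros z Hz. left. apply phi_self_map, Hz. }
rewrite Es in phi_sup_lt1. simpl in phi_sup_lt1.
set (a := phi (RtoC 0)) in *.
assert (D0 : in_disc (RtoC 0)) by (unfold in_disc; rewrite Cmod_0; lra).
assert (Has : (Cmod a <= s)%R) by (apply Hphi, D0).
assert (Ha : (0 < Cmod a)%R) by (apply Cmod_gt_0; exact phi0_neq0).
assert (Hx : (0 < sqrt (1 - Cmod a ^ 2))%R) by (apply sqrt_lt_R0; nra).
set (x := sqrt (1 - Cmod a ^ 2)%R) in *.
assert (Den : forall z, in_disc z -> (1 - Cmod a * s <= Cmod (1 - Cconj a * phi z))%R).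
{ intros z Hz.
  assert (T := Cmod_triangle (1 - Cconj a * phi z) (Cconj a * phi z)).
  replace (1 - Cconj a * phi z + Cconj a * phi z) with (RtoC 1) in T by ring.
  rewrite Cmod_1, Cmod_mult, Cmod_conj in T.
  assert (P := Hphi z Hz). assert (Q := Cmod_ge_0 (phi z)). nra. }
assert (Pos : (0 < 1 - Cmod a * s)%R) by nra.
assert (Nz : forall z, in_disc z -> 1 - Cconj a * phi z <> RtoC 0).
{ intros z Hz. apply Cmod_gt_0. assert (P := Den z Hz). lra. }
assert (Mod : forall z, in_disc z ->
   Cmod (RtoC x / (1 - Cconj a * phi z)) = (x / Cmod (1 - Cconj a * phi z))%R).
{ intros z Hz. rewrite Cmod_div by (apply Nz, Hz). rewrite Cmod_R, Rabs_pos_eq; lra. }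
destruct (sup_norm_finite (fun z => RtoC x / (1 - Cconj a * phi z)) (x / (1 - Cmod a * s)))
  as [M [EM [HM HMk]]].
{ intros z Hz. rewrite Mod by auto. apply Rmult_le_compat_l; [lra|].
  apply Rinv_le_contravar; auto. }
change (Rbar_le (op_norm (comp_op phi)) (sup_norm (fun z => RtoC x / (1 - Cconj a * phi z))) /\
  Rbar_lt (sup_norm (fun z => RtoC x / (1 - Cconj a * phi z)))
    (sqrt ((1 + Cmod a) / (1 - Cmod a))%R)).
rewrite EM. split.
- unfold op_norm, Rbar_lub. destruct Rbar_ex_lub as [l [Hub Hl]]; simpl proj1_sig.
  apply Hl. intros N [f [[Hf _] [Hf1 ->]]].
  apply comp_norm_le with s; auto.
  + apply disc_diff_of_analytic; auto.
  + lra.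
  + lra.
  + intros z Hz. fold a. fold x. assert (P := HMk z Hz). rewrite Mod in P by auto.
    assert (D := Den z Hz).
    apply Rmult_le_compat_r with (r := Cmod (1 - Cconj a * phi z)) in P; [|lra].
    unfold Rdiv in P. rewrite Rmult_assoc, Rinv_l, Rmult_1_r in P by lra. exact P.
  + apply disc_diff_of_analytic; auto.
- simpl. apply Rle_lt_trans with (1 := proj2 HM).
  replace (sqrt _) with (x / (1 - Cmod a))%R.
  + apply Rmult_lt_compat_l; auto. apply Rinv_lt_contravar; nra.
  + rewrite <- (sqrt_pow2 (1 - Cmod a)) at 1 by lra.
    unfold x. rewrite <- sqrt_div; [|nra|apply pow_lt; lra].
    f_equal. field. lra.
Qed.
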